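(* Let $\mathcal{S}$ be a computable sparse set of positive integers with a computable sparsity exponent. Then there is an algorithm that, given a rational $\varepsilon$ with $0<\varepsilon<2/3$, produces the base-$2$ expansion of a number $x(\varepsilon)\in\mathcal{C}(\mathcal{S})$ that is normal in every odd base. That is, there is a computable function which, given any rational $\varepsilon\in(0,2/3)$ and any integer $n\ge1$, outputs a digit $b_n(\varepsilon)\in\{0,1\}$, such that for each such $\varepsilon$ the number $x(\varepsilon)=\sum_{n\ge1}b_n(\varepsilon)2^{-n}$, whose base-$2$ expansion is $b_1(\varepsilon),b_2(\varepsilon),\dots$, belongs to $\mathcal{C}(\mathcal{S})$ and is normal in every odd base.
   Context: $\log$ is the natural logarithm. For a set $\mathcal{S}$ of positive integers and integers $a,c$, $S(a,c)=\#(\mathcal{S}\cap[a,c])$, where $[a,c]$ is the set of integers between $a$ and $c$ inclusive. The set $\mathcal{S}$ is called sparse if it has (asymptotic) density zero and there exists a real number $\rho>0$ (called a sparsity exponent) such that $$\liminf_{k\to\infty}\ \min_{0\le a\le k^{\rho}}\frac{S(a,a+k)}{30\log k}>1,$$ where $k$ and $a$ range over integers. The sparse Cantor set is $\mathcal{C}(\mathcal{S})=\{x\in[0,1): x=\sum_{k\in\mathcal{S}} b_k2^{-k},\ b_k\in\{0,1\}\}$. A base is an integer $\ge 2$. The base-$b$ expansion of a real $x$ is the digit sequence $b_1(x),b_2(x),\dots\in\{0,\dots,b-1\}$ with $x=\lfloor x\rfloor+\sum_{j\ge1}b_j(x)b^{-j}$ that does not end with a tail of digits $b-1$. A real number $x$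 is simply normal in base $b$ if each digit $0,\dots,b-1$ occurs with asymptotic frequency $1/b$ in its base-$b$ expansion, and normal in base $b$ if it is simply normal in base $b^k$ for every $k\ge1$. A function on non-negative integers is computable if it belongs to the smallest class of functions containing the constant functions, successor and projections and closed under composition, primitive recursion and unbounded minimization (rationals are coded by non-negative integers in a standard way). A set of positive integers is computable if its characteristic function is a computable function defined on all positive integers. A real number is computable if there is a computable function giving, for each $n$, the $n$-th digit of its expansion in some prescribed base. *)

(* Defs.v *)
From HB Require Import structures.
From mathcomp Require Import all_boot all_order all_algebra.
From mathcomp Require Import all_classical all_reals all_analysis.

Set Implicit Arguments.
Unset Strict Implicit.
Unset Printing Implicit Defensive.

Import Order.TTheory GRing.Theory Num.Theory.
Import numFieldNormedType.Exports.

Local Open Scope classical_set_scope.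
Local Open Scope ring_scope.

(* A k-ary partial function on nat, given by its graph. *)
Definition pfun (k : nat) := k.-tuple nat -> nat -> Prop.

Definition pcomp (m k : nat) (f : pfun m) (g : 'I_m -> pfun k) : pfun k :=
  fun v y => exists w : m.-tuple nat, (forall i, g i v (tnth w i)) /\ f w y.

Fixpoint primrec_at (k : nat) (f : pfun k) (g : pfun k.+2) (n : nat)
    (v : k.-tuple nat) (y : nat) : Prop :=
  if n is n'.+1 then
    exists z, primrec_at f g n' v z /\ g [tuple of n' :: z :: v] y
  else f v y.

(* h(0, v) = f(v) and h(n+1, v) = g(n, h(n, v), v). *)
Definition primrec (k : nat) (f : pfun k) (g : pfun k.+2) : pfun k.+1 :=
  fun v => primrec_at f g (thead v) [tuple of behead v].

(* The least n with f(n, v) = 0, f(i, v) being defined for all i < n. *)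
Definition minimize (k : nat) (f : pfun k.+1) : pfun k :=
  fun v n => f [tuple of n :: v] 0%N /\
    forall i, (i < n)%N -> exists y, f [tuple of i :: v] y.+1.

Inductive computable : forall k : nat, pfun k -> Prop :=
| computable_const (k c : nat) :
    computable ((fun _ y => y = c) : pfun k)
| computable_succ :
    computable ((fun v y => y = (thead v).+1) : pfun 1)
| computable_proj (k : nat) (i : 'I_k) :
    computable ((fun v y => y = tnth v i) : pfun k)
| computable_comp (m k : nat) (f : pfun m) (g : 'I_m -> pfun k) :
    computable f -> (forall i, computable (g i)) -> computable (pcomp f g)
| computable_primrec (k : nat) (f : pfun k) (g : pfun k.+2) :
    computable f -> computable g -> computable (primrec f g)
| computable_minimize (k : nat) (f : pfun k.+1) :
    computable f -> computable (minimize f).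

(* Through the coding c, some computable partial function is defined on all
   of D and agrees there with f; nothing is required outside D. *)
Definition computable_on (T : Type) (k : nat) (c : T -> k.-tuple nat)
    (D : set T) (f : T -> nat) : Prop :=
  exists2 p : pfun k, computable p &
    forall t, D t -> forall y, p (c t) y <-> y = f t.

Definition nat_code (n : nat) : 1.-tuple nat := [tuple n].

Definition int_code (z : int) : nat :=
  match z with Posz n => n.*2 | Negz n => n.*2.+1 end.

Definition cantor_pair (m n : nat) : nat := ('C((m + n).+1, 2) + m)%N.

(* numq q / denq q is the expression of q in lowest terms with denq q > 0. *)
Definition rat_code (q : rat) : nat :=
  cantor_pair (int_code (numq q)) `|denq q|%N.

Definition rat_nat_code (qn : rat * nat) : 2.-tuple nat :=
  [tuple rat_code qn.1; qn.2].

Definition computable_set (S : set nat) : Prop :=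
  computable_on nat_code [set n | (0 < n)%N] (fun n => nat_of_bool (n \in S)).

Definition cardS (S : set nat) (a c : nat) : nat :=
  count (fun i => i \in S) (index_iota a c.+1).

Definition density_zero (R : realType) (S : set nat) : Prop :=
  (cardS S 1 n)%:R / n%:R @[n --> \oo] --> (0 : R).

(* The minimum is over the integers 0 <= a <= k ^ rho; the default value of the
   iterated minimum is the term a = 0, which always belongs to the range. The
   liminf is taken in the extended reals because the sequence can diverge. *)
Definition sparsity_exponent (R : realType) (S : set nat) (rho : R) : Prop :=
  let ratio (k a : nat) : R := (cardS S a (a + k))%:R / (30 * ln k%:R) in
  0 < rho /\
  (1 < limn_einf (fun k : nat =>
     (\big[Num.min/ratio k 0%N]_(0 <= a < (Num.truncn (k%:R `^ rho)).+1)
        ratio k a)%:E))%E.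

Definition sparse (R : realType) (S : set nat) : Prop :=
  density_zero R S /\ exists rho : R, sparsity_exponent S rho.

Definition sparse_cantor (R : realType) (S : set nat) : set R :=
  [set x : R | 0 <= x < 1 /\
    exists b : nat -> bool,
      (\sum_(0 <= k < n | k \in S) (b k)%:R / 2 ^+ k) @[n --> \oo] --> x].

(* Digits are indexed from 1; d 0 plays no role. *)
Definition is_expansion (R : realType) (b : nat) (x : R) (d : nat -> nat) :
    Prop :=
  [/\ forall j, (0 < j)%N -> (d j < b)%N,
      (\sum_(1 <= j < n.+1) (d j)%:R / b%:R ^+ j) @[n --> \oo]
        --> x - (Num.floor x)%:~R
    & ~ exists N : nat, forall j, (N <= j)%N -> d j = b.-1].

Definition simply_normal_in_base (R : realType) (b : nat) (x : R) : Prop :=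
  exists2 d : nat -> nat, is_expansion b x d &
    forall a, (a < b)%N ->
      (count (fun j => d j == a) (index_iota 1 n.+1))%:R / n%:R @[n --> \oo]
        --> (b%:R^-1 : R).

Definition normal_in_base (R : realType) (b : nat) (x : R) : Prop :=
  forall k, (0 < k)%N -> simply_normal_in_base (b ^ k)%N x.

Definition computable_real (R : realType) (x : R) : Prop :=
  exists2 b : nat, (1 < b)%N &
    exists2 d : nat -> nat, is_expansion b x d &
      computable_on nat_code [set n | (0 < n)%N] d.

(* Main.v *)
Require Import Defs.
From HB Require Import structures.
From mathcomp Require Import all_boot all_order all_algebra.
From mathcomp Require Import all_classical all_reals all_analysis.
From mathcomp Require Import ring lra zify.

Set Implicit Arguments.
Unset Strict Implicit.
Unset Printing Implicit Defensive.

Import Order.TTheory GRing.Theory Num.Theory.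
Import numFieldNormedType.Exports.

(** The number is [x = sum_(k in S) e_k 2^-k] for well chosen bits [e_k].
    For independent fair bits, almost every such [x] is normal in every odd base,
    the exceptional sets have explicitly summable measures, and a greedy choice of
    the bits avoids them all. Powers of odd bases are odd, so that it suffices to make
    [x] simply normal in each odd base [Q > 2].

    Frequencies. A positive trigonometric polynomial of degree less than [M], a sum of
    translates of the Fejer kernel over the grid of step [1/M], dominates the indicator
    of a digit interval up to a small relative error ([few_hits]). Hence a digit can only be too frequent among
    the first [N] ones if an exponential sum [sum_(n < N) e(h Q^n x)] with
    [0 < h < M] is not small. A digit that is too rare makes another one too frequent,
    so upper bounds are enough ([simply_normal_of_upper]).

    Second moment. The mean square of such a sum is an average over pairs [i <= j] of the
    expectation of [e(L x)], with [L = h Q^i (Q^(j-i) - 1)]. Integrating the bits out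
    one by one bounds this expectation by the product of the [|cos (pi L / 2^s)|]
    over [s] in [S] ([sum_cos_masked]). Write [h (Q^d - 1) = 2^a o] with [o] odd.
    The 2-adic valuation of [Q^d - 1] exceeds that of [d] by a bounded amount only; thus [a]
    is small for most [d], and for fixed [d] the residues of [o Q^i] modulo [2^k] are
    spread out: each is taken a bounded number of times when [i] runs over [2^k]
    consecutive integers ([residue_spacing]). So the mean of the product over [i]
    is controlled by its mean over all residues modulo [2^k], which is at most
    [2^(-c/2)], where [c] counts the elements of [S] from [a + 1] to [a + k]: the leading
    binary digit of a residue shifts one angle by [pi / 2], which turns its cosine into a
    sine, and [|cos| + |sin| <= sqrt 2] gains a factor for each element
    ([cos_prod_average]). Sparsity provides [c >= 30 log k - 1] elements for all
    the relevant [a], which are of the order of [log k] ([sparse_dense]). For [N] about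
    [2^k] the resulting bound is a power of [1/k] that beats all losses: for
    [g = log2 k], the words that misbehave for some base below [g] and some
    [N = c 2^k], [c < 4 g], have density at most [1/(k (k + 1))]
    ([good_almost_all]). These [N] are dense enough on a logarithmic scale to control all
    the others ([normal_of_good]).

    Computability. Whether a word of [8^k] bits behaves well at level [k] is decided by
    counting digits of integers. The next bit is chosen by counting, among the
    extensions of both candidates, those that behave well up to a level growing
    exponentially with the number of bits chosen so far; the invariant is that the well behaved
    extensions keep a density larger than what the remaining levels can destroy
    ([greedy_heavy]). The level from which the density bounds hold is a constant of the
    resulting primitive recursive program. *)

(** * Total computable functions *)

Local Open Scope nat_scope.

(** Arguments are the entries of a list, read with [nth 0 s i], so that variables bound by
    a recursion, a sum or a quantifier are simply pushed in front of the list. *)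
Definition tcomp (k : nat) (F : seq nat -> nat) : Prop :=
  computable ((fun v y => y = F v) : pfun k).

Lemma tcomp_graph k (p : pfun k) (F : seq nat -> nat) :
  computable p -> (forall v y, p v y <-> y = F v) -> tcomp k F.
Proof.
move=> cp pF; rewrite /tcomp.
suff -> : (fun v y => y = F v) = p :> pfun k by [].
by apply/funext => v; apply/funext => y; apply/propext; rewrite pF.
Qed.

Lemma tcomp_ext k (F F' : seq nat -> nat) :
  (forall s, size s = k -> F s = F' s) -> tcomp k F -> tcomp k F'.
Proof.
by move=> FF' cF; apply: tcomp_graph cF _ => v y; rewrite FF' ?size_tuple.
Qed.

Lemma tcomp_const k c : tcomp k (fun=> c).
Proof. exact: computable_const. Qed.

Lemma tcomp_nth k i : tcomp k (fun s => nth 0 s i).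
Proof.
have [ik|ki] := ltnP i k; last first.
  apply: (@tcomp_ext k (fun=> 0)) => [s sk|]; last exact: tcomp_const.
  by rewrite nth_default ?sk.
apply: tcomp_graph (computable_proj (Ordinal ik)) _ => v y.
by rewrite (tnth_nth 0).
Qed.

Lemma tcomp_comp m k F (Gs : seq (seq nat -> nat)) :
  size Gs = m -> tcomp m F ->
  (forall i, i < m -> tcomp k (nth (fun=> 0) Gs i)) ->
  tcomp k (fun s => F [seq G s | G <- Gs]).
Proof.
move=> sGs cF cGs.
apply: tcomp_graph (computable_comp cF (fun i => cGs i (ltn_ord i))) _ => v y.
have E (w : m.-tuple nat) :
    (forall i, tnth w i = nth (fun=> 0) Gs i (tval v)) -> w = [seq G (tval v) | G <- Gs] :> seq _.
  move=> wv; apply: (@eq_from_nth _ 0) => [|i]; first by rewrite size_map size_tuple.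
  rewrite size_tuple => im; rewrite (nth_map (fun=> 0)) ?sGs//.
  by rewrite -(wv (Ordinal im)) (tnth_nth 0).
split=> [[w [wv ->]]|->]; first by rewrite E.
exists [tuple nth (fun=> 0) Gs i (tval v) | i < m]; split=> [i|]; first by rewrite tnth_mktuple.
by rewrite E // => i; rewrite tnth_mktuple.
Qed.

Lemma tcomp_op1 (f : nat -> nat) k F :
  tcomp 1 (fun s => f (nth 0 s 0)) -> tcomp k F -> tcomp k (fun s => f (F s)).
Proof.
move=> cf cF.
by apply: (@tcomp_comp 1 k (fun s => f (nth 0 s 0)) [:: F]) => // -[].
Qed.

Lemma tcomp_op2 (f : nat -> nat -> nat) k F G :
  tcomp 2 (fun s => f (nth 0 s 0) (nth 0 s 1)) -> tcomp k F -> tcomp k G ->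
  tcomp k (fun s => f (F s) (G s)).
Proof.
move=> cf cF cG.
by apply: (@tcomp_comp 2 k (fun s => f (nth 0 s 0) (nth 0 s 1)) [:: F; G]) => // -[|[]].
Qed.

Lemma tcomp_op3 (f : nat -> nat -> nat -> nat) k F G H :
  tcomp 3 (fun s => f (nth 0 s 0) (nth 0 s 1) (nth 0 s 2)) ->
  tcomp k F -> tcomp k G -> tcomp k H ->
  tcomp k (fun s => f (F s) (G s) (H s)).
Proof.
move=> cf cF cG cH.
by apply: (@tcomp_comp 3 k (fun s => f (nth 0 s 0) (nth 0 s 1) (nth 0 s 2))
  [:: F; G; H]) => // -[|[|[]]].
Qed.

Lemma tcomp_succ k F : tcomp k F -> tcomp k (fun s => (F s).+1).
Proof.
apply: tcomp_op1; apply: tcomp_graph computable_succ _ => v y.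
by rewrite /thead (tnth_nth 0).
Qed.

Lemma map_nth_iota (s : seq nat) : [seq nth 0 s i | i <- iota 0 (size s)] = s.
Proof.
apply: (@eq_from_nth _ 0); rewrite size_map size_iota // => i i_s.
by rewrite (nth_map 0) ?size_iota // nth_iota.
Qed.

(** The number of steps [N s] and the parameters [s] are supplied to primitive recursion by
    composition. *)
Lemma tcomp_natrec k (N F G : seq nat -> nat) :
  tcomp k N -> tcomp k F -> tcomp k.+2 G ->
  tcomp k (fun s => nat_rect (fun=> nat) (F s) (fun i z => G [:: i, z & s]) (N s)).
Proof.
move=> cN cF cG.
pose H s := nat_rect (fun=> nat) (F (behead s)) (fun i z => G [:: i, z & behead s]) (nth 0 s 0).
have cH : tcomp k.+1 H.
  apply: tcomp_graph (computable_primrec cF cG) _ => v y.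
  rewrite /primrec /H /thead (tnth_nth 0).
  elim: (nth 0 v 0) y => [|n IH] y //=.
  split=> [[z [/IH -> ->]]//|->].
  by eexists; split; first exact/IH.
pose Gs := N :: [seq (fun s => nth 0 s i) | i <- iota 0 k].
apply: (@tcomp_ext _ (fun s => H [seq G s | G <- Gs])) => [s sk|].
  by rewrite /H /= -map_comp -sk /= map_nth_iota.
apply: tcomp_comp cH _ => [|[|i]] /=; rewrite ?size_map ?size_iota // => ik.
by rewrite (nth_map 0) ?size_iota // nth_iota //; exact: tcomp_nth.
Qed.

Lemma tcomp_behead k F : tcomp k F -> tcomp k.+1 (fun s => F (behead s)).
Proof.
move=> cF; pose Gs := [seq (fun s => nth 0 s i.+1) | i <- iota 0 k].
apply: (@tcomp_ext _ (fun s => F [seq G s | G <- Gs])) => [s sk|].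
  congr F; rewrite /Gs -map_comp /= -[RHS]map_nth_iota size_behead sk /=.
  by apply: eq_map => i; rewrite /= nth_behead.
apply: tcomp_comp cF _ => [|i]; rewrite ?size_map ?size_iota // => ik.
by rewrite (nth_map 0) ?size_iota // nth_iota //; exact: tcomp_nth.
Qed.

Lemma tcomp_add k F G : tcomp k F -> tcomp k G -> tcomp k (fun s => F s + G s).
Proof.
move=> cF cG.
apply: (@tcomp_ext _ (fun s => nat_rect (fun=> nat) (G s) (fun _ z => z.+1) (F s))) => [s _|].
  by elim: (F s) => //= n ->.
apply: (@tcomp_natrec _ _ _ (fun s => (nth 0 s 1).+1)) => //.
by apply: tcomp_succ; exact: tcomp_nth.
Qed.

Lemma tcomp_sum k (N F : seq nat -> nat) :
  tcomp k N -> tcomp k.+1 F -> tcomp k (fun s => \sum_(i < N s) F (nat_of_ord i :: s)).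
Proof.
move=> cN cF.
apply: (@tcomp_ext _ (fun s => nat_rect (fun=> nat) 0 (fun i z => z + F (i :: s)) (N s))) => [s _|].
  by elim: (N s) => [|n IH]; rewrite ?big_ord0 // big_ord_recr /= IH.
apply: (@tcomp_natrec _ _ _ (fun s => nth 0 s 1 + F (nth 0 s 0 :: behead (behead s)))) => //.
  exact: tcomp_const.
apply: tcomp_add; first exact: tcomp_nth.
pose Gs := (fun s => nth 0 s 0) :: [seq (fun s => nth 0 s i.+2) | i <- iota 0 k].
apply: (@tcomp_ext _ (fun s => F [seq G s | G <- Gs])).
  move=> s sk /=; congr (F (_ :: _)); rewrite -map_comp -[RHS]map_nth_iota !size_behead sk /=.
  by apply: eq_map => i; rewrite /= !nth_behead.
apply: tcomp_comp cF _ => [|[|i]] /=; rewrite ?size_map ?size_iota // => ik; first exact: tcomp_nth.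
by rewrite (nth_map 0) ?size_iota // nth_iota //; exact: tcomp_nth.
Qed.

Lemma tcomp_mul k F G : tcomp k F -> tcomp k G -> tcomp k (fun s => F s * G s).
Proof.
move=> cF cG; apply: (@tcomp_ext _ (fun s => \sum_(i < F s) G s)) => [s _|].
  by rewrite sum_nat_const card_ord.
by apply: (@tcomp_sum _ _ (fun s => G (behead s))) => //; exact: tcomp_behead.
Qed.

Lemma tcomp_exp k F G : tcomp k F -> tcomp k G -> tcomp k (fun s => F s ^ G s).
Proof.
move=> cF cG.
apply: (@tcomp_ext _ (fun s => nat_rect (fun=> nat) 1 (fun _ z => F s * z) (G s))) => [s _|].
  by elim: (G s) => //= n ->; rewrite expnS.
apply: (@tcomp_natrec _ _ _ (fun s => F (behead (behead s)) * nth 0 s 1)) => //.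
  exact: tcomp_const.
apply: tcomp_mul; last exact: tcomp_nth.
exact/(@tcomp_behead k.+1 (fun s => F (behead s)))/tcomp_behead.
Qed.

Lemma tcomp_pred k F : tcomp k F -> tcomp k (fun s => (F s).-1).
Proof.
move=> cF; apply: (@tcomp_ext _ (fun s => nat_rect (fun=> nat) 0 (fun i _ => i) (F s))) => [s _|].
  by case: (F s).
by apply: (@tcomp_natrec _ _ _ (fun s => nth 0 s 0)) => //; [exact: tcomp_const | exact: tcomp_nth].
Qed.

Lemma tcomp_sub k F G : tcomp k F -> tcomp k G -> tcomp k (fun s => F s - G s).
Proof.
move=> cF cG.
apply: (@tcomp_ext _ (fun s => nat_rect (fun=> nat) (F s) (fun _ z => z.-1) (G s))) => [s _|].
  by elim: (G s) => /= [|n ->]; rewrite ?subn0 ?subnS.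
apply: (@tcomp_natrec _ _ _ (fun s => (nth 0 s 1).-1)) => //.
by apply: tcomp_pred; exact: tcomp_nth.
Qed.

Lemma tcomp_leq k F G : tcomp k F -> tcomp k G -> tcomp k (fun s => F s <= G s).
Proof.
move=> cF cG; apply: (@tcomp_ext _ (fun s => 1 - (F s - G s))) => [s _|].
  by rewrite -subn_eq0; case: (F s - G s).
by apply: tcomp_sub; [exact: tcomp_const | exact: tcomp_sub].
Qed.

Lemma tcomp_neg k (P : seq nat -> bool) : tcomp k P -> tcomp k (fun s => ~~ P s).
Proof.
move=> cP; apply: (@tcomp_ext _ (fun s => 1 - P s)) => [s _|]; first by case: (P s).
by apply: tcomp_sub => //; exact: tcomp_const.
Qed.

Lemma tcomp_and k (P Q : seq nat -> bool) :
  tcomp k P -> tcomp k Q -> tcomp k (fun s => P s && Q s).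
Proof.
move=> cP cQ; apply: (@tcomp_ext _ (fun s => P s * Q s)) => [s _|].
  by case: (P s); case: (Q s).
exact: tcomp_mul.
Qed.

Lemma tcomp_or k (P Q : seq nat -> bool) :
  tcomp k P -> tcomp k Q -> tcomp k (fun s => P s || Q s).
Proof.
move=> cP cQ; apply: (@tcomp_ext _ (fun s => ~~ (~~ P s && ~~ Q s))) => [s _|].
  by rewrite negb_and !negbK.
by apply: tcomp_neg; apply: tcomp_and; exact: tcomp_neg.
Qed.

Lemma tcomp_eq k F G : tcomp k F -> tcomp k G -> tcomp k (fun s => F s == G s).
Proof.
move=> cF cG; apply: (@tcomp_ext _ (fun s => (F s <= G s) && (G s <= F s))) => [s _|].
  by rewrite eqn_leq.
by apply: tcomp_and; exact: tcomp_leq.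
Qed.

(** The quotient counts the multiples of [G s] that are positive and at most [F s]. *)
Lemma tcomp_div k F G : tcomp k F -> tcomp k G -> tcomp k (fun s => F s %/ G s).
Proof.
move=> cF cG.
apply: (@tcomp_ext _ (fun s => \sum_(i < F s) ((0 < G s) && (i.+1 * G s <= F s)))) => [s _|].
  have [->|G0] := posnP (G s); first by rewrite divn0 big1.
  have -> : F s %/ G s = \sum_(i < F s %/ G s) 1 by rewrite sum1_card card_ord.
  rewrite (big_ord_widen (F s) (fun=> 1)) ?leq_div //.
  rewrite [RHS]big_mkcond /=; apply: eq_bigr => i _.
  by rewrite leq_divRL //; case: leqP.
apply: (@tcomp_sum _ _ (fun s =>
  (0 < G (behead s)) && ((nth 0 s 0).+1 * G (behead s) <= F (behead s)))) => //.
apply: tcomp_and; apply: tcomp_leq.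
- exact: tcomp_const.
- exact: tcomp_behead.
- by apply: tcomp_mul; [apply: tcomp_succ; exact: tcomp_nth | exact: tcomp_behead].
- exact: tcomp_behead.
Qed.

Lemma tcomp_mod k F G : tcomp k F -> tcomp k G -> tcomp k (fun s => F s %% G s).
Proof.
move=> cF cG; apply: (@tcomp_ext _ (fun s => F s - F s %/ G s * G s)) => [s _|].
  by rewrite {1}(divn_eq (F s) (G s)) addKn.
by apply: tcomp_sub => //; apply: tcomp_mul => //; exact: tcomp_div.
Qed.

Lemma tcomp_all k (N : seq nat -> nat) (P : seq nat -> bool) :
  tcomp k N -> tcomp k.+1 P ->
  tcomp k (fun s => [forall i : 'I_(N s), P (nat_of_ord i :: s)]).
Proof.
move=> cN cP.
apply: (@tcomp_ext _ (fun s => \sum_(i < N s) ~~ P (nat_of_ord i :: s) == 0)) => [s _|].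
  rewrite sum_nat_eq0; congr (nat_of_bool _).
  by apply: eq_forallb => i; rewrite eqb0 negbK.
apply: tcomp_eq; last exact: tcomp_const.
by apply: (@tcomp_sum _ _ (fun s => ~~ P s)) => //; exact: tcomp_neg.
Qed.

Lemma tcomp_implb k (P Q : seq nat -> bool) :
  tcomp k P -> tcomp k Q -> tcomp k (fun s => P s ==> Q s).
Proof.
move=> cP cQ; apply: (@tcomp_ext _ (fun s => ~~ P s || Q s)) => [s _|].
  by rewrite implybE.
by apply: tcomp_or => //; exact: tcomp_neg.
Qed.

Lemma tcomp_odd k F : tcomp k F -> tcomp k (fun s => odd (F s)).
Proof.
move=> cF; apply: (@tcomp_ext _ (fun s => F s %% 2)) => [s _|]; first by rewrite modn2.
by apply: tcomp_mod => //; exact: tcomp_const.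
Qed.

(** Matching on the syntax keeps the unifier from unfolding defined predicates. *)
Ltac computability := repeat (cbv beta; first [assumption | exact: tcomp_nth |
  lazymatch goal with
  | |- tcomp _ (fun _ => S _) => apply: tcomp_succ
  | |- tcomp _ (fun _ => predn _) => apply: tcomp_pred
  | |- tcomp _ (fun _ => addn _ _) => apply: tcomp_add
  | |- tcomp _ (fun _ => subn _ _) => apply: tcomp_sub
  | |- tcomp _ (fun _ => muln _ _) => apply: tcomp_mul
  | |- tcomp _ (fun _ => expn _ _) => apply: tcomp_exp
  | |- tcomp _ (fun _ => divn _ _) => apply: tcomp_div
  | |- tcomp _ (fun _ => modn _ _) => apply: tcomp_mod
  | |- tcomp _ (fun _ => nat_of_bool (andb _ _)) => apply: tcomp_and
  | |- tcomp _ (fun _ => nat_of_bool (orb _ _)) => apply: tcomp_or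
  | |- tcomp _ (fun _ => nat_of_bool (implb _ _)) => apply: tcomp_implb
  | |- tcomp _ (fun _ => nat_of_bool (negb _)) => apply: tcomp_neg
  | |- tcomp _ (fun _ => nat_of_bool (odd _)) => apply: tcomp_odd
  | |- tcomp _ (fun _ => nat_of_bool (eq_op _ _)) => apply: tcomp_eq
  | |- tcomp _ (fun _ => nat_of_bool (leq _ _)) => apply: tcomp_leq
  | |- tcomp _ (fun _ => _) => exact: tcomp_const
  end]).

(** * Greedy derandomization of effectively summable constraints *)

(** Words of length [p] are encoded as integers below [2 ^ p], most significant bit first;
    truncating a word amounts to dividing by a power of two. *)
Fixpoint prefix_word (b : nat -> bool) (p : nat) : nat :=
  if p is p'.+1 then 2 * prefix_word b p' + b p' else 0.

Lemma sum_divn a b (f : nat -> nat) :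
  0 < b -> \sum_(u < a * b) f (u %/ b) = b * \sum_(v < a) f v.
Proof.
move=> b0; rewrite -(big_mkord xpredT (fun u => f (u %/ b))) -(big_mkord xpredT f).
elim: a => [|a IH]; first by rewrite mul0n !big_geq ?muln0.
rewrite mulSn addnC (big_cat_nat (n := a * b)) ?leq_addr //= IH big_nat_recr //= mulnDr.
congr (_ + _); rewrite -{1}[a * b]add0n big_addn addKn.
rewrite (eq_big_nat _ _ (F2 := fun=> f a)) ?sum_nat_const_nat ?subn0 //.
by move=> i /andP[_ ib]; rewrite addnC divnMDl // divn_small // addn0.
Qed.

Section Derandomization.
Variables (good : nat -> nat -> bool) (len : nat -> nat) (k0 : nat).

Definition all_good j u :=
  [forall k : 'I_j, (k0 <= k) ==> good k (u %/ 2 ^ (len j - len k))].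

Definition cylinder_count p w j :=
  \sum_(u < 2 ^ len j) ((u %/ 2 ^ (len j - p) == w) && all_good j u).

Definition light p w j := cylinder_count p w j * j < 2 * 2 ^ len j.

(** After [p] bits, the levels below [j = 4 ^ p * k0] have been taken into account, and the
    invariant is that a proportion at least [2 / j] of all words lies in the chosen
    cylinder and is good at these levels. The levels from [j] on destroy a proportion of at most
    [1 / j], so [1 / j] remains for the levels below [4 * j]; one of the two halves of
    the cylinder keeps half of it, that is [2 / (4 * j)]. *)
Definition greedy p :=
  nat_rect (fun=> nat) 0
    (fun i w => 2 * w + light i.+1 (2 * w) (4 ^ i.+1 * k0)) p.

Hypothesis len_homo : {homo len : i j / i <= j}.
Hypothesis len_ge : forall j, j <= len j.
Hypothesis k0_gt1 : 1 < k0.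
Hypothesis good_ae : forall k, k0 <= k ->
  k * k.+1 * \sum_(v < 2 ^ len k) ~~ good k v <= 2 ^ len k.

Lemma cylinder_count_step p w j : k0 <= j -> p <= len j ->
  j * j.+1 * 2 ^ (len j.+1 - len j) * cylinder_count p w j <=
  j * j.+1 * cylinder_count p w j.+1 + 2 ^ len j.+1.
Proof.
move=> kj pj; have jj := len_homo (leqnSn j).
set D := len j.+1 - len j.
have LE : 2 ^ len j.+1 = 2 ^ len j * 2 ^ D by rewrite -expnD subnKC.
have D0 : 0 < 2 ^ D by rewrite expn_gt0.
rewrite -mulnA /cylinder_count -(sum_divn _ (fun u => (u %/ 2 ^ (len j - p) == w) && all_good j u)) //.
have := leq_mul (good_ae kj) (leqnn (2 ^ D)).
rewrite -LE -!mulnA [_ * 2 ^ D in X in X -> _]mulnC -(sum_divn _ (fun v => (~~ good j v))) // -LE.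
rewrite mulnA -[in X in X -> _](leq_add2l (j * j.+1 * \sum_(u < 2 ^ len j.+1)
  ((u %/ 2 ^ (len j.+1 - p) == w) && all_good j.+1 u))).
move=> /(leq_trans _); rewrite !mulnA; apply.
rewrite -mulnDr leq_mul2l -big_split /=; apply/orP; right.
apply: leq_sum => u _.
rewrite -divnMA -expnD.
have -> : (D + (len j - p) = len j.+1 - p) by rewrite /D; lia.
case: (_ == w) => //=.
case G: (good j _) => /=; last by rewrite addn1 (leq_trans (leq_b1 _)).
rewrite addn0; case: (boolP (all_good j _)) => //= /forallP A.
rewrite lt0b; apply/forallP => -[k kj1] /=; apply/implyP => kk.
move: (kj1); rewrite ltnS leq_eqVlt => /predU1P[->|kj2].
  by rewrite -/D.
have /implyP /= := A (Ordinal kj2); rewrite -divnMA -expnD => /(_ kk).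
have kl := len_homo (ltnW kj2).
by have -> : (D + (len j - len k) = len j.+1 - len k) by rewrite /D; lia.
Qed.

Lemma cylinder_count_split p w j : p < len j ->
  cylinder_count p w j =
  cylinder_count p.+1 (2 * w) j + cylinder_count p.+1 (2 * w).+1 j.
Proof.
move=> pj; rewrite /cylinder_count -big_split /=; apply: eq_bigr => u _.
have -> : len j - p = len j - p.+1 + 1 by lia.
rewrite expnD expn1 divnMA; set v := u %/ _.
case: (all_good _ _); rewrite ?andbT ?andbF //.
have := divn_eq v 2; have := ltn_mod v 2.
by case: eqP; case: eqP; case: eqP; lia.
Qed.

Local Open Scope ring_scope.

Definition cylinder_density p w j : rat := (cylinder_count p w j)%:R / 2 ^+ len j.

(** Passing from level [n] to level [n + 1] costs at most
    [1 / (n (n + 1)) = 1 / n - 1 / (n + 1)], and these losses telescope. *)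
Lemma cylinder_density_mono p w i j : (k0 <= i)%N -> (p <= len i)%N -> (i <= j)%N ->
  cylinder_density p w i - i%:R^-1 <= cylinder_density p w j - j%:R^-1.
Proof.
move=> ki pi /subnKC <-; elim: (j - i)%N => [|d IH]; first by rewrite addn0.
apply: le_trans IH _; rewrite addnS; set m := (i + d)%N.
have km : (k0 <= m)%N by rewrite /m; lia.
have pm : (p <= len m)%N by apply: leq_trans pi _; apply: len_homo; rewrite /m; lia.
have := cylinder_count_step w km pm.
rewrite -(ler_nat rat) natrD !natrM !natrX /cylinder_density.
have mm := len_homo (leqnSn m).
have -> : len m.+1 = (len m + (len m.+1 - len m))%N by rewrite subnKC.
rewrite addKn exprD.
have m0 : 0 < m%:R :> rat by rewrite ltr0n; lia.
have x0 : 0 < 2 ^+ len m :> rat by rewrite exprn_gt0.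
have y0 : 0 < 2 ^+ (len m.+1 - len m) :> rat by rewrite exprn_gt0.
rewrite -(natr1 m).
move: m0 x0 y0; move: (cylinder_count _ _ m)%:R (cylinder_count _ _ m.+1)%:R => a b.
move: m%:R (2 ^+ len m) (2 ^+ (len m.+1 - len m)) => n x y n0 x0 y0 H.
have n1 : n + 1 != 0 by lra.
have nn : n != 0 by lra.
have xn : x != 0 by lra.
have yn : y != 0 by lra.
rewrite -subr_ge0.
have -> : b / (x * y) - (n + 1)^-1 - (a / x - n^-1) =
  (n * (n + 1) * b + x * y - n * (n + 1) * y * a) / (n * (n + 1) * (x * y)).
  by field; rewrite nn xn yn n1.
by apply: divr_ge0; [lra | rewrite !mulr_ge0 //; lra].
Qed.

Lemma greedy_heavy p :
  ~~ light p (greedy p) (4 ^ p * k0).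
Proof.
have lightE q w j : (0 < j)%N ->
    light q w j = (cylinder_density q w j < 2 / j%:R).
  move=> j0; rewrite /light -(ltr_nat rat) !natrM natrX /cylinder_density.
  have j0' : 0 < j%:R :> rat by rewrite ltr0n.
  by rewrite ltr_pdivlMr // mulrAC ltr_pdivrMr // exprn_gt0.
have start : cylinder_density 0 0 k0 = 1.
  rewrite /cylinder_density /cylinder_count (eq_bigr (fun=> 1%N)) => [|u _].
    by rewrite sum1_card card_ord natrX divff // expf_neq0.
  rewrite subn0 divn_small ?ltn_ord //= /all_good.
  suff -> : [forall k : 'I_k0, (k0 <= k)%N ==> good k (u %/ 2 ^ (len k0 - len k))] by [].
  by apply/forallP => k; rewrite leqNgt ltn_ord.
have j0 q : (0 < 4 ^ q * k0)%N by rewrite muln_gt0 expn_gt0; lia.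
elim: p => [|p IH].
  rewrite expn0 mul1n lightE; last by lia.
  rewrite start -leNgt ler_pdivrMr ?ltr0n ?mul1r; last by lia.
  by rewrite ler_nat.
rewrite /greedy /= -/(greedy p).
case H : (light p.+1 (2 * greedy p) _) => /=; last by rewrite addn0 H.
rewrite addn1.
move: IH H; rewrite !lightE // -!leNgt.
set j := (4 ^ p * k0)%N; set j' := (4 ^ p.+1 * k0)%N.
have jj : j' = (4 * j)%N by rewrite /j' expnS -mulnA.
have p4 : (p < 4 ^ p)%N by apply: ltn_expl.
have pj : (p < j)%N by rewrite /j; nia.
have pl : (p <= len j)%N by apply: leq_trans (len_ge j); lia.
have jpos : 0 < j%:R :> rat by rewrite ltr0n; lia.
(* The half with bit 0 has been rejected for being light, so the other one is heavy. *)
have := @cylinder_density_mono p (greedy p) j j' _ pl _.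
have -> : cylinder_density p (greedy p) j' = cylinder_density p.+1 (2 * greedy p) j'
    + cylinder_density p.+1 (2 * greedy p).+1 j'.
  rewrite /cylinder_density -mulrDl -natrD -cylinder_count_split //.
  by apply: leq_trans (len_ge j'); lia.
have k0j : (k0 <= j)%N by rewrite /j; nia.
have jj' : (j <= j')%N by lia.
move=> /(_ k0j jj').
have -> : j'%:R^-1 = j%:R^-1 / 4 :> rat.
  by rewrite jj natrM invfM mulrC.
have ipos : 0 < j%:R^-1 :> rat by rewrite invr_gt0.
lra.
Qed.

Lemma greedy_prefix p : greedy p = prefix_word (fun i => (greedy i.+1 %% 2 == 1)%N) p.
Proof.
elim: p => //= p <-; congr (_ + _)%N.
by rewrite mulnC modnMDl; case: (light _ _ _).
Qed.

(** A heavy cylinder contains at least one good word, whose truncation to [len k] bits is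
    the chosen prefix as soon as at least [len k] bits have been chosen. *)
Lemma greedy_good k : (k0 <= k)%N -> good k (greedy (len k)).
Proof.
move=> kk; set p := len k.
have := greedy_heavy p; set j := (4 ^ p * k0)%N.
have p4 : (p < 4 ^ p)%N by apply: ltn_expl.
have pj : (p < j)%N by rewrite /j; nia.
have kp : (k <= p)%N by exact: len_ge.
rewrite /light -leqNgt => H.
have : (0 < cylinder_count p (greedy p) j)%N.
  rewrite lt0n; apply/eqP => E; move: H; rewrite E mul0n leqNgt => /negP; apply.
  by rewrite muln_gt0 expn_gt0.
rewrite lt0n sum_nat_eq0 => /forallPn[/= u].
rewrite eqb0 negbK => /andP[/eqP <- /forallP ug].
have kj : (k < j)%N by lia.
by have /implyP /(_ kk) := ug (Ordinal kj).
Qed.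
End Derandomization.

Lemma tcomp_greedy (good : nat -> nat -> bool) len k0 :
  tcomp 2 (fun s => good (nth 0 s 0) (nth 0 s 1)) ->
  tcomp 1 (fun s => len (nth 0 s 0)) ->
  tcomp 1 (fun s => greedy good len k0 (nth 0 s 0)).
Proof.
move=> cg cl.
have cg' k F G : tcomp k F -> tcomp k G -> tcomp k (fun s => good (F s) (G s)).
  exact: (@tcomp_op2 good).
have cl' k F : tcomp k F -> tcomp k (fun s => len (F s)) by exact: (@tcomp_op1 len).
have c_all k F G : tcomp k F -> tcomp k G ->
    tcomp k (fun s => all_good good len k0 (F s) (G s)).
  apply: (@tcomp_op2 (all_good good len k0)).
  apply: (@tcomp_all _ _ (fun s => (k0 <= nth 0 s 0) ==>
    good (nth 0 s 0) (nth 0 s 2 %/ 2 ^ (len (nth 0 s 1) - len (nth 0 s 0))))).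
    by computability.
  by computability; apply: cg'; computability; apply: cl'; computability.
have c_cnt k F G H : tcomp k F -> tcomp k G -> tcomp k H ->
    tcomp k (fun s => cylinder_count good len k0 (F s) (G s) (H s)).
  apply: (@tcomp_op3 (cylinder_count good len k0)).
  apply: (@tcomp_sum _ _ (fun s => (nth 0 s 0 %/ 2 ^ (len (nth 0 s 3) - nth 0 s 1) == nth 0 s 2)
    && all_good good len k0 (nth 0 s 3) (nth 0 s 0))).
    by computability; apply: cl'; computability.
  computability; first by apply: cl'; computability.
  by apply: c_all; computability.
apply: (@tcomp_natrec _ _ _ (fun s => 2 * nth 0 s 1 + light good len k0 (nth 0 s 0).+1
  (2 * nth 0 s 1) (4 ^ (nth 0 s 0).+1 * k0))); computability.
rewrite /light; computability.
- by apply: c_cnt; computability.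
- by apply: cl'; computability.
Qed.

(** The threshold [k0] is a constant of the program, which makes its mere existence
    sufficient. *)
Lemma computable_derandomization (good : nat -> nat -> bool) (len : nat -> nat) (k0 : nat) :
  tcomp 2 (fun s => good (nth 0 s 0) (nth 0 s 1)) ->
  tcomp 1 (fun s => len (nth 0 s 0)) ->
  {homo len : i j / i <= j} -> (forall j, j <= len j) ->
  (forall k, k0 <= k ->
     k * k.+1 * \sum_(v < 2 ^ len k) ~~ good k v <= 2 ^ len k) ->
  exists2 b : nat -> bool, tcomp 1 (fun s => b (nth 0 s 0)) &
    forall k, k0 <= k -> 1 < k -> good k (prefix_word b (len k)).
Proof.
move=> cg cl lh lg ae; pose k1 := maxn k0 2.
exists (fun i => greedy good len k1 i.+1 %% 2 == 1).
  apply: tcomp_eq; last exact: tcomp_const.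
  apply: tcomp_mod; last exact: tcomp_const.
  apply: (@tcomp_op1 (greedy good len k1)); first exact: tcomp_greedy.
  by apply: tcomp_succ; exact: tcomp_nth.
move=> k kk k1k; rewrite -greedy_prefix; apply: greedy_good => //.
- by rewrite leq_max orbT.
- by move=> i ik; apply: ae; apply: leq_trans ik; rewrite leq_maxl.
- by rewrite geq_max kk.
Qed.

(** * Exponential sums and the Fejer kernel *)

Local Open Scope ring_scope.

Section Trigonometry.
Variable R : realType.
Implicit Types (x y t : R).

Lemma sin_le_id x : 0 <= x -> sin x <= x.
Proof.
rewrite le_eqVlt => /predU1P[<-|x0]; first by rewrite sin0.
have [|c _] := @MVT R (@sin R) (@cos R) 0 x x0 (fun y _ => is_derive_sin y).
  exact/continuous_subspaceT/continuous_sin.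
rewrite sin0 !subr0 => ->; rewrite -[leRHS]mul1r.
by rewrite ler_wpM2r ?cos_le1 // ltW.
Qed.

Lemma sin_ge_half x : 0 <= x <= 1 -> x / 2 <= sin x.
Proof.
case/andP; rewrite le_eqVlt => /predU1P[<-|x0 x1]; first by rewrite sin0 mul0r.
have [|c] := @MVT R (@sin R) (@cos R) 0 x x0 (fun y _ => is_derive_sin y).
  exact/continuous_subspaceT/continuous_sin.
rewrite in_itv /= => /andP[c0 cx]; rewrite sin0 !subr0 => ->; rewrite mulrC ler_wpM2r ?(ltW x0) //.
have -> : c = (c / 2) *+ 2 by rewrite -mulr_natr; field.
have c20 : 0 <= c / 2 by rewrite divr_ge0 // ltW.
rewrite cos_mulr2n cos2sin2.
have : sin (c / 2) ^+ 2 <= (1 / 2) ^+ 2.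
  rewrite ler_sqr ?nnegrE ?divr_ge0 //.
    by apply: le_trans (sin_le_id c20) _; lra.
  apply: sin_ge0_pi; rewrite c20 /=.
  by have := pi_ge2 R; lra.
have -> : (1 / 2) ^+ 2 = 1 / 4 :> R by field.
lra.
Qed.

(** A weak form of Jordan's inequality: [d] bounds from below the distance of [t] to the
    integers, and [t <= 1 / 2] may be assumed by symmetry. *)
Lemma sin_pi_ge (d t : R) : 0 <= d -> d <= t <= 1 - d -> d <= sin (pi * t).
Proof.
move=> d0; wlog t2 : t / t <= 1 / 2 => [W|] dt.
  have [|t2] := leP t (1 / 2); first by move/W; exact.
  have -> : sin (pi * t) = sin (pi * (1 - t)).
    have -> : pi * (1 - t) = - (pi * t) + pi by ring.
    by rewrite sinDpi sinN opprK.
  by apply: W; lra.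
have p2 := pi_ge2 R.
have pt : 2 * t <= pi * t by rewrite ler_wpM2r //; lra.
have [p1|p1] := leP (pi * t) 1.
  by have := @sin_ge_half (pi * t); lra.
apply: (@le_trans _ _ (sin 1)).
  by have := @sin_ge_half 1; lra.
have p12 := pihalf_ge1 R.
have pt2 : pi * t <= pi / 2.
  by have : pi * t <= pi * (1 / 2) by [rewrite ler_wpM2l //; lra]; lra.
by rewrite leNgt ltr_sin ?bnd_simp -?leNgt ?in_itv /=; lra.
Qed.

(** The closed form of a geometric sum of exponentials, in real terms. *)
Lemma sum_cos_telescope (M : nat) (th a : R) :
  2 * sin a * (\sum_(j < M) cos (th + 2 * j%:R * a)) =
  sin (th + (2 * M%:R - 1) * a) - sin (th - a).
Proof.
elim: M => [|M IH].
  by rewrite big_ord0 mulr0 mulr0 sub0r mulN1r subrr.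
rewrite big_ord_recr /= mulrDr IH.
have -> : th + (2 * M.+1%:R - 1) * a = th + 2 * M%:R * a + a.
  by rewrite -natr1; ring.
have -> : th + (2 * M%:R - 1) * a = th + 2 * M%:R * a - a by ring.
rewrite (sinD _ a) (sinB _ a); ring.
Qed.

(** The squared modulus of the exponential sum [\sum_k e^(i x_k)]. *)
Definition circle_sq (I : finType) (x : I -> R) : R :=
  (\sum_i cos (x i)) ^+ 2 + (\sum_i sin (x i)) ^+ 2.

Lemma circle_sq_double (I : finType) (x : I -> R) :
  circle_sq x = \sum_i \sum_j cos (x i - x j).
Proof.
rewrite /circle_sq !expr2 !big_distrlr -big_split; apply: eq_bigr => i _.
by rewrite -big_split; apply: eq_bigr => j _; rewrite cosB.
Qed.

Lemma circle_sq_ge0 (I : finType) (x : I -> R) : 0 <= circle_sq x.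
Proof. by rewrite addr_ge0 ?sqr_ge0. Qed.

(** The left-hand side is the length of the projection of the exponential sum on the direction
    of angle [th]. *)
Lemma sum_cos_shift_le (I : finType) (x : I -> R) (th B : R) :
  0 <= B -> circle_sq x <= B ^+ 2 -> `|\sum_i cos (x i - th)| <= B.
Proof.
move=> B0 xB; rewrite -(ger0_norm B0) -ler_sqr ?nnegrE // !real_normK ?num_real //.
apply: le_trans xB; rewrite /circle_sq.
under eq_bigr do rewrite cosB.
rewrite big_split /= -!mulr_suml.
move: (\sum_i cos _) (\sum_i sin _) => a b.
have := cos2Dsin2 th; move: (cos th) (sin th) => c s cs.
rewrite -subr_ge0.
have -> : a ^+ 2 + b ^+ 2 - (a * c + b * s) ^+ 2 =
  (a * s - b * c) ^+ 2 + (a ^+ 2 + b ^+ 2) * (1 - (c ^+ 2 + s ^+ 2)) by ring.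
by rewrite cs subrr mulr0 addr0 sqr_ge0.
Qed.

(** The Fejer kernel, up to a factor [M]. *)
Definition fejer (M : nat) t : R := circle_sq (fun j : 'I_M => 2 * pi * j%:R * t).

Lemma fejer_ge0 M t : 0 <= fejer M t.
Proof. exact: circle_sq_ge0. Qed.

(** The kernel is the squared modulus of a geometric sum of ratio [e^(2 i pi t)], and
    [2 |sin (pi t)|] is the modulus of this ratio minus one. *)
Lemma fejer_tail M t : sin (pi * t) ^+ 2 * fejer M t <= 1.
Proof.
set a := pi * t.
have C : 2 * sin a * (\sum_(j < M) cos (2 * pi * j%:R * t)) =
    sin ((2 * M%:R - 1) * a) + sin a.
  rewrite (eq_bigr (fun j : 'I_M => cos (0 + 2 * j%:R * a))) => [|j _].
    by rewrite sum_cos_telescope add0r sub0r sinN opprK.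
  by congr cos; rewrite /a; ring.
have S : 2 * sin a * (\sum_(j < M) sin (2 * pi * j%:R * t)) =
    cos a - cos ((2 * M%:R - 1) * a).
  rewrite (eq_bigr (fun j : 'I_M => cos (- (pi / 2) + 2 * j%:R * a))) => [|j _].
    rewrite sum_cos_telescope -opprD sinN [pi / 2 + a]addrC sinDpihalf opprK.
    by rewrite [- (pi / 2) + _]addrC sinBpihalf addrC.
  by rewrite -cosBpihalf addrC; congr (cos (_ + _)); rewrite /a; ring.
have : 4 * (sin a ^+ 2 * fejer M t) <= 4.
  have -> : 4 * (sin a ^+ 2 * fejer M t) =
     (2 * sin a * (\sum_(j < M) cos (2 * pi * j%:R * t))) ^+ 2 +
     (2 * sin a * (\sum_(j < M) sin (2 * pi * j%:R * t))) ^+ 2.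
    by rewrite /fejer /circle_sq; ring.
  rewrite C S; set b := _ * a.
  have -> : (sin b + sin a) ^+ 2 + (cos a - cos b) ^+ 2 =
    (cos a ^+ 2 + sin a ^+ 2) + (cos b ^+ 2 + sin b ^+ 2)
     - 2 * (cos a * cos b - sin a * sin b) by ring.
  by rewrite !cos2Dsin2 -cosD; have := cos_geN1 (a + b); lra.
lra.
Qed.

Lemma cos_periodN t (n : nat) : cos (t + 2 * pi * n%:R) = cos t.
Proof.
have -> : 2 * pi * n%:R = pi *+ 2 *+ n :> R by rewrite mulr_natr mulr_natl.
by rewrite (periodicn (@cosD2pi R)).
Qed.

Lemma sin_periodN t (n : nat) : sin (t + 2 * pi * n%:R) = sin t.
Proof.
have -> : 2 * pi * n%:R = pi *+ 2 *+ n :> R by rewrite mulr_natr mulr_natl.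
by rewrite (periodicn (@sinD2pi R)).
Qed.

Lemma fejer_period M t (n : nat) : fejer M (t + n%:R) = fejer M t.
Proof.
rewrite /fejer /circle_sq; congr (_ ^+ 2 + _ ^+ 2); apply: eq_bigr => j _.
  have -> : 2 * pi * j%:R * (t + n%:R) = 2 * pi * j%:R * t + 2 * pi * (j * n)%N%:R :> R.
    by rewrite natrM; ring.
  exact: cos_periodN.
have -> : 2 * pi * j%:R * (t + n%:R) = 2 * pi * j%:R * t + 2 * pi * (j * n)%N%:R :> R.
  by rewrite natrM; ring.
exact: sin_periodN.
Qed.

Lemma sum_cos_grid M (h : nat) (th : R) : (0 < h < M)%N ->
  \sum_(i < M) cos (th + 2 * i%:R * (pi * (h%:R / M%:R))) = 0.
Proof.
case/andP=> h0 hM; have M0 : 0 < M%:R :> R by rewrite ltr0n; lia.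
set a := pi * _.
have sa : sin a != 0.
  have hM' : h%:R / M%:R < 1 :> R by rewrite ltr_pdivrMr // mul1r ltr_nat.
  have hM0 : 0 < h%:R / M%:R :> R by rewrite divr_gt0 // ltr0n.
  apply: lt0r_neq0; apply: sin_gt0_pi; have p0 := pi_gt0 R.
  by rewrite mulr_gt0 //= -[ltRHS]mulr1 ltr_pM2l.
have s2 : 2 * sin a != 0 by rewrite mulf_eq0 negb_or sa andbT; lra.
apply: (mulfI s2); rewrite mulr0 sum_cos_telescope.
have -> : th + (2 * M%:R - 1) * a = th - a + 2 * pi * h%:R.
  by rewrite /a; field; rewrite gt_eqF.
by rewrite sin_periodN subrr.
Qed.

(** Frequencies of the kernel are less than [M] in absolute value, so that the [M]-point
    grid annihilates all of them but zero. *)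
Lemma fejer_parseval M t : \sum_(i < M) fejer M (t - i%:R / M%:R) = M%:R ^+ 2.
Proof.
have [->|M0] := posnP M; first by rewrite big_ord0 expr0n.
have MR : M%:R != 0 :> R by rewrite pnatr_eq0; lia.
under eq_bigr do rewrite /fejer circle_sq_double.
rewrite exchange_big /= (eq_bigr (fun=> M%:R)) => [|j _].
  by rewrite sumr_const card_ord expr2 mulr_natr.
rewrite exchange_big /= (bigD1 j) //= [X in _ + X]big1 => [|j' jj'].
  rewrite addr0 (eq_bigr (fun=> 1)) => [|i _]; last by rewrite subrr cos0.
  by rewrite sumr_const card_ord.
have [jl|jl|/val_inj jl] := ltngtP j j'.
- rewrite -[RHS](@sum_cos_grid M (j' - j) (2 * pi * j%:R * t - 2 * pi * j'%:R * t)).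
    by apply: eq_bigr => i _; rewrite natrB 1?ltnW //; congr cos; field.
  by rewrite subn_gt0 jl /=; have := ltn_ord j'; lia.
- rewrite -[RHS](@sum_cos_grid M (j - j') (2 * pi * j'%:R * t - 2 * pi * j%:R * t)).
    apply: eq_bigr => i _; rewrite natrB 1?ltnW // -cosN; congr cos; field.
    by [].
  by rewrite subn_gt0 jl /=; have := ltn_ord j; lia.
- by rewrite jl eqxx in jj'.
Qed.
End Trigonometry.

(** * From small exponential sums to digit frequencies *)

Lemma le_of_eq (R : numDomainType) (x y : R) : x = y -> x <= y.
Proof. by move->. Qed.

Section FewHits.
Variable R : realType.

(** The [M] constant terms of the kernel contribute [N] each; every other term is controlled by
    an exponential sum of positive frequency less than [M]. *)
Lemma fejer_sum_le (N M : nat) (y : 'I_N -> R) (tau t : R) : 0 <= tau ->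
  (forall h : nat, (0 < h < M)%N ->
     circle_sq (fun n => 2 * pi * h%:R * y n) <= (tau * N%:R) ^+ 2) ->
  \sum_n fejer M (y n - t) <= M%:R * N%:R + M%:R ^+ 2 * tau * N%:R.
Proof.
move=> tau0 W; have tN : 0 <= tau * N%:R by rewrite mulr_ge0.
under eq_bigr do rewrite /fejer circle_sq_double.
rewrite exchange_big /=.
apply: (@le_trans _ _ (\sum_(j < M) (N%:R + M%:R * (tau * N%:R)))); last first.
  by rewrite sumr_const card_ord -mulr_natl; apply/le_of_eq; ring.
apply: ler_sum => j _; rewrite exchange_big /=.
apply: (@le_trans _ _ (\sum_(i < M) ((i == j)%:R * N%:R + tau * N%:R))); last first.
  rewrite big_split /= (bigD1 j) //= eqxx big1 => [|i /negPf->]; last by rewrite mul0r.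
  by rewrite mul1r addr0 sumr_const card_ord mulr_natl.
apply: ler_sum => i _; have [->|ij] := eqVneq i j.
  rewrite (eq_bigr (fun=> 1)) => [|n _]; last by rewrite subrr cos0.
  by rewrite sumr_const card_ord mul1r lerDl.
rewrite mul0r add0r.
have H (h : nat) : (0 < h < M)%N ->
    \sum_n cos (2 * pi * h%:R * y n - 2 * pi * h%:R * t) <= tau * N%:R.
  by move=> hM; apply: le_trans (ler_norm _) _; exact: sum_cos_shift_le (W _ hM).
have [jl|jl|/val_inj jl] := ltngtP i j.
- apply: le_trans (H (j - i)%N _); last by have := ltn_ord j; lia.
  apply/le_of_eq/eq_bigr => n _; rewrite natrB 1?ltnW //; congr cos; ring.
- apply: le_trans (H (i - j)%N _); last by have := ltn_ord i; lia.
  by apply/le_of_eq/eq_bigr => n _; rewrite natrB 1?ltnW // -cosN; congr cos; ring.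
- by rewrite jl eqxx in ij.
Qed.

(** A point [y] that is congruent modulo 1 to a point [f] at distance at least [d / M] from
    the ends of the arc [s / M, (s + c) / M] receives nearly all its mass from the grid
    points of the arc: at the other grid points the kernel is at most [(M / d) ^ 2]. *)
Lemma fejer_mass (M s c d : nat) (y f : R) (z z' : nat) :
  (0 < d)%N -> (0 < M)%N -> y + z%:R = f + z'%:R ->
  s%:R + d%:R <= f * M%:R -> f * M%:R + d%:R <= s%:R + c%:R ->
  M%:R ^+ 2 - M%:R ^+ 3 / d%:R ^+ 2 <=
  \sum_(i < M | (i < c)%N) fejer M (y - s%:R / M%:R - i%:R / M%:R).
Proof.
move=> d0 M0 yf sf fs.
have MR : 0 < M%:R :> R by rewrite ltr0n.
have dR : 0 < d%:R :> R by rewrite ltr0n.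
rewrite -(fejer_parseval M (y - s%:R / M%:R)) (bigID (fun i : 'I_M => (i < c)%N)) /=.
rewrite lerBlDr lerD2l.
apply: (@le_trans _ _ (\sum_(i < M) M%:R ^+ 2 / d%:R ^+ 2)); last first.
  by rewrite sumr_const card_ord -mulr_natl; apply/le_of_eq; ring.
rewrite [leLHS]big_mkcond /=; apply: ler_sum => i _.
case: ltnP => ci /=; first by rewrite divr_ge0 // exprn_ge0 ?ler0n.
set t := _ - _.
have -> : fejer M t = fejer M (f - s%:R / M%:R - i%:R / M%:R).
  rewrite -(fejer_period M t z) -[RHS](fejer_period _ _ z'); congr fejer.
  by rewrite /t; lra.
set t' := _ - _.
pose q := i%:R / M%:R + s%:R / M%:R - f.
have iM : i%:R + 1 <= M%:R :> R by rewrite natr1 ler_nat.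
have ic : c%:R <= i%:R :> R by rewrite ler_nat.
have E : q * M%:R = i%:R + s%:R - f * M%:R by rewrite /q; field; rewrite gt_eqF.
have := @sin_pi_ge _ (d%:R / M%:R) q.
have d0' : 0 <= d%:R / M%:R :> R by rewrite divr_ge0 ?ltW.
have dq : d%:R / M%:R <= q by rewrite ler_pdivrMr // E; lra.
have qd : q <= 1 - d%:R / M%:R.
  by rewrite -(ler_pM2r MR) E mulrBl divfK ?gt_eqF //; lra.
move=> /(_ d0'); rewrite dq qd => /(_ isT) H.
have := fejer_tail M t'.
have -> : pi * t' = - (pi * q) by rewrite /t' /q; ring.
rewrite sinN sqrrN => T.
rewrite -expr_div_n -[_ / _]invf_div exprVn -[leRHS]mul1r ler_pdivlMr ?exprn_gt0 ?divr_gt0 //.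
apply: le_trans T; rewrite mulrC ler_wpM2r ?fejer_ge0 //.
by rewrite ler_sqr ?nnegrE //; apply: le_trans H.
Qed.

(** Sum the kernel over all points and all grid points of an arc: by smallness of
    the exponential sums the total is about [c M N], while each point well inside the arc
    contributes about [M ^ 2]. *)
Lemma few_hits (N M s c d : nat) (tau : R) (y : 'I_N -> R) (H : pred 'I_N) :
  (0 < d)%N -> (0 < M)%N -> (c <= M)%N -> 0 <= tau ->
  (forall h : nat, (0 < h < M)%N ->
     circle_sq (fun n => 2 * pi * h%:R * y n) <= (tau * N%:R) ^+ 2) ->
  (forall n, H n -> exists f : R, exists z z' : nat,
     [/\ y n + z%:R = f + z'%:R, s%:R + d%:R <= f * M%:R
       & f * M%:R + d%:R <= s%:R + c%:R]) ->
  (\sum_n H n)%N%:R * (M%:R - M%:R ^+ 2 / d%:R ^+ 2) <=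
  c%:R * (1 + M%:R * tau) * N%:R.
Proof.
move=> d0 M0 cM tau0 W Hn.
have MR : 0 < M%:R :> R by rewrite ltr0n.
rewrite -(ler_pM2l MR).
apply: (@le_trans _ _ (\sum_n \sum_(i < M | (i < c)%N)
    fejer M (y n - s%:R / M%:R - i%:R / M%:R))).
  rewrite natr_sum mulr_suml mulr_sumr; apply: ler_sum => n _.
  case Hy : (H n); last first.
    by rewrite mul0r mulr0 sumr_ge0 // => i _; exact: fejer_ge0.
  have [f [z [z' [E1 E2 E3]]]] := Hn n Hy.
  apply: le_trans (fejer_mass d0 M0 E1 E2 E3).
  by rewrite [true%:R]/(1%:R) mul1r; apply/le_of_eq; ring.
rewrite exchange_big /=.
apply: (@le_trans _ _ (\sum_(i < M | (i < c)%N) (M%:R * N%:R + M%:R ^+ 2 * tau * N%:R))).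
  apply: ler_sum => i _.
  rewrite (eq_bigr (fun n => fejer M (y n - (s%:R / M%:R + i%:R / M%:R)))) => [|n _].
    exact: fejer_sum_le.
  by rewrite opprD addrA.
set K := _ + _; rewrite -(big_ord_widen M (fun=> K)) // sumr_const card_ord.
rewrite -[K *+ c]mulr_natr /K.
by apply/le_of_eq; ring.
Qed.
End FewHits.

(** The numerator over [2 ^ l] of the real number whose binary digits are those of the
    word [u], erased at the positions rejected by [m]. *)
Definition masked (m : nat -> bool) (l u : nat) : nat :=
  (\sum_(i < l) m i * (u %/ 2 ^ (l - i.+1) %% 2) * 2 ^ (l - i.+1))%N.

Lemma masked_step m l u (c : bool) :
  masked m l.+1 (2 * u + c) = (2 * masked m l u + m l * c)%N.
Proof.
rewrite /masked big_ord_recr /= subnn expn0 divn1 muln1; congr (_ + _)%N; last first.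
  by rewrite [(2 * u)%N]mulnC modnMDl; case: c.
rewrite big_distrr /=; apply: eq_bigr => i _.
have -> : (l.+1 - i.+1 = 1 + (l - i.+1))%N by have := ltn_ord i; lia.
rewrite expnD expn1 divnMA [(2 * u)%N]mulnC divnMDl //.
have -> : (c %/ 2 = 0)%N by case: c.
by rewrite addn0 mulnCA mulnA.
Qed.

Lemma sum_pow2S (V : nmodType) p (f : nat -> V) :
  \sum_(u < 2 ^ p.+1) f u = \sum_(v < 2 ^ p) (f (2 * v)%N + f (2 * v).+1).
Proof.
rewrite expnS mulnC -(big_mkord xpredT f).
rewrite -(big_mkord xpredT (fun v => f (2 * v)%N + f (2 * v).+1)).
elim: (2 ^ p)%N => [|a IH]; first by rewrite mul0n !big_geq.
by rewrite mulSn !big_nat_recr //= IH mulnC addrA.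
Qed.

Section Expectation.
Variable R : realType.

Definition cos_prod (m : nat -> bool) (l x : nat) : R :=
  \prod_(i < l | m i) `|cos (pi * x%:R / 2 ^+ i.+1)|.

(** Up to the normalization by [2 ^ l], this bounds the expectation of a character at a random
    point. The last bit is integrated out by [cos t + cos (t + 2 a) = 2 cos a cos (t + a)]. *)
Lemma sum_cos_masked m l (L : nat) (th : R) :
  `|\sum_(u < 2 ^ l) cos (th + 2 * pi * L%:R * ((masked m l u)%:R / 2 ^+ l))| <=
  2 ^+ l * cos_prod m l L.
Proof.
elim: l th => [|l IH] th.
  rewrite /masked /cos_prod expn0 expr0 big_ord1 !big_ord0 mul1r.
  by rewrite cos_max.
rewrite (sum_pow2S l (fun u => cos (th + 2 * pi * L%:R * ((masked m l.+1 u)%:R / 2 ^+ l.+1)))).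
pose a : R := (m l)%:R * (pi * L%:R / 2 ^+ l.+1).
have x0 : 2 ^+ l != 0 :> R by rewrite expf_neq0.
rewrite (eq_bigr (fun u : 'I_(2 ^ l) => 2 * cos a *
  cos (th + a + 2 * pi * L%:R * ((masked m l u)%:R / 2 ^+ l)))) => [|u _]; last first.
  have := masked_step m l u true; have := masked_step m l u false.
  rewrite addn0 addn1 muln0 addn0 muln1 => -> ->.
  set v := masked m l u; rewrite natrD natrM exprS.
  set b := th + a + _.
  have -> : th + 2 * pi * L%:R * (2%N%:R * v%:R / (2 * 2 ^+ l)) = b - a.
    by rewrite /b; field.
  have -> : th + 2 * pi * L%:R * ((2%N%:R * v%:R + (m l)%:R) / (2 * 2 ^+ l)) = b + a.
    by rewrite /b /a exprS; field.
  by rewrite cosB cosD; ring.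
rewrite -mulr_sumr normrM.
have -> : 2 ^+ l.+1 * cos_prod m l.+1 L = `|2 * cos a| * (2 ^+ l * cos_prod m l L).
  rewrite /cos_prod big_mkcond big_ord_recr -big_mkcond /= normrM ger0_norm //.
  by rewrite /a exprS; case: (m l); rewrite ?mul1r ?mul0r ?cos0 ?normr1 ?exprS; ring.
by rewrite ler_wpM2l.
Qed.

Lemma cos_prod_ge0 m l x : 0 <= cos_prod m l x.
Proof. by apply: prodr_ge0. Qed.

Lemma cos_prod_le1 m l x : cos_prod m l x <= 1.
Proof. by apply: prodr_ile1 => i _; rewrite normr_ge0 cos_max. Qed.

Lemma norm_cosDpi (x : R) (n : nat) : `|cos (x + pi * n%:R)| = `|cos x|.
Proof. by rewrite mulr_natr alternatingn ?normrM ?normrX ?normrN1 ?expr1n ?mul1r //; exact: cosDpi. Qed.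

Lemma cos_prod_period m l x q : cos_prod m l (x + 2 ^ l * q) = cos_prod m l x.
Proof.
apply: eq_bigr => i _; rewrite -[RHS](norm_cosDpi _ (2 ^ (l - i.+1) * q)).
congr (`|cos _|).
have -> : (2 ^ l = 2 ^ i.+1 * 2 ^ (l - i.+1))%N by rewrite -expnD subnKC.
rewrite natrD !natrM !natrX; field.
by rewrite expf_neq0.
Qed.

Lemma cos_prod_mod m l x : cos_prod m l (x %% 2 ^ l) = cos_prod m l x.
Proof. by rewrite {2}(divn_eq x (2 ^ l)) addnC mulnC cos_prod_period. Qed.

(** The first [a] factors are equal to 1, and dropping them is harmless since all factors are
    at most 1. *)
Lemma cos_prod_shift m a l w :
  cos_prod m (a + l) (2 ^ a * w) <= cos_prod (fun t => m (a + t)%N) l w.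
Proof.
rewrite /cos_prod big_mkcond big_split_ord -big_mkcond /= -[leRHS]mul1r.
rewrite [X in _ * X <= _](_ : _ = cos_prod (fun t => m (a + t)%N) l w); last first.
  rewrite /cos_prod -big_mkcond /=; apply: eq_bigr => i _; congr (`|cos _|).
  by rewrite natrM natrX -addnS exprD; field; rewrite !expf_neq0.
rewrite ler_wpM2r ?cos_prod_ge0 //.
by apply: prodr_ile1 => i _; rewrite normr_ge0 cos_max.
Qed.

Lemma cos_prod_trunc m a l x : cos_prod m (a + l) x <= cos_prod m a x.
Proof.
rewrite /cos_prod big_mkcond big_split_ord -big_mkcond /= -[leRHS]mulr1.
rewrite ler_wpM2l ?cos_prod_ge0 // -big_mkcond.
by apply: prodr_ile1 => i _; rewrite normr_ge0 cos_max.
Qed.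

Lemma cos_sin_le (x : R) : `|cos x| + `|sin x| <= 2 * (Num.sqrt 2)^-1.
Proof.
have s2 : 2 * (Num.sqrt 2)^-1 = Num.sqrt 2 :> R.
  by rewrite -{1}(@sqr_sqrtr _ 2) // expr2 mulfK // gt_eqF // sqrtr_gt0.
rewrite s2 -ler_sqr ?nnegrE ?addr_ge0 ?sqrtr_ge0 // sqr_sqrtr //.
have := cos2Dsin2 x; rewrite -[cos x ^+ 2]real_normK ?num_real //.
rewrite -[sin x ^+ 2]real_normK ?num_real // => E.
have := sqr_ge0 (`|cos x| - `|sin x|).
by rewrite sqrrB sqrrD; lra.
Qed.

(** The leading binary digit of [u] only matters for the last factor, where it adds [pi / 2]
    to the angle and turns a cosine into a sine. Averaging over it gains
    a factor [sqrt 2 / 2], by [cos_sin_le], for each position accepted by [m]. *)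
Lemma cos_prod_average m k :
  \sum_(u < 2 ^ k) cos_prod m k u <=
  2 ^+ k * (Num.sqrt 2)^-1 ^+ (\sum_(t < k) m t).
Proof.
elim: k => [|k IH].
  by rewrite expn0 big_ord1 big_ord0 !expr0 mulr1 cos_prod_le1.
have E : (2 ^ k.+1 = 2 ^ k + 2 ^ k)%N by rewrite expnS mul2n addnn.
have cpS x : cos_prod m k.+1 x =
   cos_prod m k x * (if m k then `|cos (pi * x%:R / 2 ^+ k.+1)| else 1).
  by rewrite /cos_prod big_mkcond big_ord_recr -big_mkcond.
rewrite E big_split_ord /= -big_split /=.
rewrite big_ord_recr /= exprD exprS.
pose s : R := if m k then (Num.sqrt 2)^-1 else 1.
have -> : (Num.sqrt 2)^-1 ^+ m k = s by rewrite /s; case: (m k).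
have s0 : 0 <= s by rewrite /s; case: (m k); rewrite ?invr_ge0 ?sqrtr_ge0.
apply: (@le_trans _ _ (\sum_(u < 2 ^ k) cos_prod m k u * (2 * s))); last first.
  rewrite -mulr_suml [leRHS](_ : _ = (2 ^+ k * (Num.sqrt 2)^-1 ^+ (\sum_(t < k) m t)) * (2 * s)).
    by rewrite ler_wpM2r // mulr_ge0.
  by ring.
apply: ler_sum => u _; rewrite !cpS.
have := cos_prod_period m k u 1; rewrite muln1 addnC => ->.
rewrite -mulrDr ler_wpM2l ?cos_prod_ge0 // /s; case: (m k); last by lra.
have -> : pi * (2 ^ k + u)%:R / 2 ^+ k.+1 = pi * u%:R / 2 ^+ k.+1 + pi / 2 :> R.
  by rewrite natrD natrX exprS; field; rewrite expf_neq0.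
by rewrite cosDpihalf normrN cos_sin_le.
Qed.
End Expectation.

(** * Powers of an odd number modulo powers of two *)

Local Open Scope nat_scope.

Section PowersModPow2.

Lemma odd_geom_sum P d : odd P -> odd (\sum_(i < d) P ^ i) = odd d.
Proof.
move=> oP; elim: d => [|d IH]; first by rewrite big_ord0.
by rewrite big_ord_recr /= oddD IH oddX oP orbT addbT.
Qed.

Lemma logn2_pow_odd P d : odd P -> 1 < P -> odd d ->
  logn 2 (P ^ d).-1 = logn 2 P.-1.
Proof.
move=> oP P1 od; rewrite predn_exp lognM; first last.
- by rewrite -(odd_geom_sum d oP) in od; case: (\sum_(_ < _) _) od.
- by case: P P1 {oP} => [|[]].
by rewrite [X in _ + X]lognE dvdn2 odd_geom_sum // od /= andbF addn0.
Qed.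

(** Odd exponents leave the valuation unchanged, the cofactor being a sum of an odd number of
    odd terms; doubling the exponent [f] multiplies by [P ^ f + 1], which is 2
    modulo 4. *)
Lemma logn2_pow_sub1_mod4 P e : P %% 4 = 1 -> 1 < P -> 0 < e ->
  logn 2 (P ^ e).-1 = logn 2 P.-1 + logn 2 e.
Proof.
move=> P4 P1; have oP : odd P by rewrite (divn_eq P 4) P4 addn1 /= oddM andbF.
elim/ltn_ind: e => e IH e0; case: (boolP (odd e)) => oe.
  by rewrite logn2_pow_odd // [X in _ = _ + X]lognE dvdn2 oe /= andbF addn0.
have e2 : e = 2 * e./2 by rewrite mul2n even_halfK // (negbTE oe).
have f0 : 0 < e./2 by lia.
have pf : 1 < P ^ e./2 by rewrite -(expn0 P) ltn_exp2l.
have -> : (P ^ e).-1 = (P ^ e./2).-1 * (P ^ e./2 + 1).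
  rewrite {1}e2 mul2n -addnn expnD; move: pf; set X := P ^ _; nia.
rewrite lognM ?addn1 //; last by lia.
rewrite IH //; last by lia.
have Pf4 : P ^ e./2 %% 4 = 1 by rewrite -modnXm P4 exp1n.
have -> : (P ^ e./2).+1 = 2 * ((P ^ e./2).+1)./2 by lia.
rewrite lognM //; last by lia.
have -> : logn 2 (P ^ e./2).+1./2 = 0.
  have -> : (P ^ e./2).+1./2 = ((P ^ e./2 %/ 4).*2).+1 by lia.
  by rewrite lognE dvdn2 /= odd_double.
by rewrite {2}e2 lognM // addn0 (pfactorK 1) // [1 + _]addnC addnA.
Qed.

(** The square of an odd number is 1 modulo 4, which reduces even exponents to the previous
    case. *)
Lemma logn2_pow_sub1_le Q d : odd Q -> 1 < Q -> 0 < d ->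
  logn 2 (Q ^ d).-1 <= logn 2 (Q ^ 2).-1 + logn 2 d.
Proof.
move=> oQ Q1 d0; case: (boolP (odd d)) => od.
  rewrite logn2_pow_odd //; apply: leq_trans (leq_addr _ _).
  have -> : (Q ^ 2).-1 = Q.-1 * Q.+1 by nia.
  by rewrite lognM ?leq_addr //; lia.
have d2 : d = 2 * d./2 by rewrite mul2n even_halfK // (negbTE od).
rewrite {1}d2 expnM logn2_pow_sub1_mod4.
- by rewrite {2}d2 lognM ?leq_add2l ?leq_addl //; lia.
- have [q ->] : exists q, Q = 2 * q + 1.
    by exists Q./2; rewrite mul2n addn1 -[LHS]odd_double_half oQ add1n.
  have -> : (2 * q + 1) ^ 2 = q * q.+1 * 4 + 1 by ring.
  by rewrite modnMDl.
- by rewrite -(expn0 Q) ltn_exp2l.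
- by lia.
Qed.

(** Two equal residues force [2 ^ k] to divide [Q ^ (j - i) - 1], whose valuation is at most
    that of [j - i] plus a constant. *)
Lemma residue_spacing Q o k i j : odd Q -> 1 < Q -> odd o -> i < j ->
  o * Q ^ i = o * Q ^ j %[mod 2 ^ k] ->
  2 ^ (k - logn 2 (Q ^ 2).-1) <= j - i.
Proof.
move=> oQ Q1 oo ij /esym/eqP; set c := logn _ _.
have d0 : 0 < j - i by rewrite subn_gt0.
have Qij : Q ^ j = Q ^ i * Q ^ (j - i) by rewrite -expnD subnKC // ltnW.
have Qd : 1 < Q ^ (j - i) by rewrite -(expn0 Q) ltn_exp2l.
rewrite eqn_mod_dvd; last by rewrite leq_mul2l leq_exp2l // (ltnW ij) orbT.
rewrite -mulnBr Qij -{2}[Q ^ i]muln1 -mulnBr mulnA Gauss_dvdr; last first.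
  by rewrite coprimeXl // coprime2n oddM oddX oo oQ orbT.
rewrite subn1 pfactor_dvdn //; last by lia.
move=> kl; apply: dvdn_leq => //; rewrite pfactor_dvdn // leq_subLR.
by apply: leq_trans kl _; exact: logn2_pow_sub1_le.
Qed.

End PowersModPow2.

Local Open Scope ring_scope.

Section SumBlocks.
Variable R : realDomainType.

Lemma sum_inj_le (P K : nat) (f : 'I_P -> 'I_K) (g : nat -> R) :
  injective f -> (forall u, 0 <= g u) -> \sum_i g (f i) <= \sum_(u < K) g u.
Proof.
move=> fI g0; rewrite [leLHS](_ : _ = \sum_(u in f @: [set: 'I_P]) g u).
  rewrite [leLHS]big_mkcond /=; apply: ler_sum => u _.
  by case: ifP.
rewrite big_imset /=; last by move=> x y _ _; exact: fI.
by apply: eq_bigl => i; rewrite inE.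
Qed.

(** On each of the [B] blocks of [P] consecutive indices, [r] is injective. *)
Lemma sum_spaced_le (B P K : nat) (r : nat -> nat) (g : nat -> R) :
  (forall i, (r i < K)%N) ->
  (forall i j, (i < j)%N -> r i = r j -> (P <= j - i)%N) ->
  (forall u, 0 <= g u) ->
  \sum_(i < B * P) g (r i) <= B%:R * \sum_(u < K) g u.
Proof.
move=> rK rP g0; elim: B => [|B IH]; first by rewrite mul0n big_ord0 mul0r.
rewrite mulSn addnC big_split_ord /= -natr1 mulrDl mul1r lerD //.
pose f (i : 'I_P) := Ordinal (rK (B * P + i)%N).
apply: (@sum_inj_le _ _ f) => // i j /(congr1 val) /= E; apply/val_inj.
have := ltn_ord i; have := ltn_ord j.
have [lt|lt|//] := ltngtP i j.
- by have := @rP (B * P + i)%N (B * P + j)%N; rewrite ltn_add2l => /(_ lt E) /=; lia.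
- by have := @rP (B * P + j)%N (B * P + i)%N; rewrite ltn_add2l => /(_ lt (esym E)) /=; lia.
Qed.
End SumBlocks.

Lemma count_multiples B P : (0 < P)%N -> (\sum_(d < B * P) (P %| d) = B)%N.
Proof.
move=> P0; elim: B => [|B IH]; first by rewrite mul0n big_ord0.
rewrite mulSn addnC big_split_ord /= IH.
rewrite (eq_bigr (fun i : 'I_P => (i == Ordinal P0 :> 'I_P) : nat)) => [|i _].
  by rewrite -big_mkcond /= big_pred1_eq addn1.
rewrite dvdn_addr ?dvdn_mull // -val_eqE /=.
have := ltn_ord i; case: (val i) => [|n] /= nP; first by rewrite dvdn0.
by rewrite gtnNdvd.
Qed.

(** The parameter [e] separates the differences [d = j - i] that are divisible by [2 ^ e],
    which are few and for which the trivial bound is used, from the other ones, for which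
    the valuation of [h (Q ^ d - 1)] is at most [A]. *)
Section SecondMoment.
Variable R : realType.
Variables (m : nat -> bool) (l Q h k e cc A : nat) (s : R).
Hypotheses (oQ : odd Q) (Q1 : (1 < Q)%N) (h0 : (0 < h)%N).
Let c := logn 2 (Q ^ 2).-1.
Let N := (cc * 2 ^ k)%N.
Hypotheses (ck : (c <= k)%N) (ek : (e <= k)%N).
Hypothesis hA : (logn 2 h + c + e <= A)%N.
Hypothesis Al : (A + k <= l)%N.
Hypothesis sA : forall a, (a <= A)%N ->
  (Num.sqrt 2)^-1 ^+ (\sum_(t < k) m (a + t))%N <= s.

Let T (i d : nat) : R := cos_prod R m l (h * (Q ^ i * (Q ^ d).-1)).

Let T_ge0 i d : 0 <= T i d. Proof. exact: cos_prod_ge0. Qed.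

Let s_ge0 : 0 <= s.
Proof. by apply: le_trans (sA (leq0n _)); rewrite exprn_ge0 ?invr_ge0 ?sqrtr_ge0. Qed.

(** The sum over [i] is compared with the sum over all residues modulo [2 ^ k] by
    [residue_spacing]; [N / 2 ^ (k - c)] blocks are needed, whence the loss [2 ^ c]. *)
Lemma orbit_sum_le d : ~~ (2 ^ e %| d)%N ->
  \sum_(i < N) T i d <= N%:R * (2 ^+ c * s).
Proof.
move=> ed; have d0 : (0 < d)%N by rewrite lt0n; apply: contraNN ed => /eqP->; rewrite dvdn0.
have Qd : (0 < (Q ^ d).-1)%N.
  by have : (1 < Q ^ d)%N by [rewrite -(expn0 Q) ltn_exp2l]; lia.
have X0 : (0 < h * (Q ^ d).-1)%N by rewrite muln_gt0 h0.
have [ o oo Xo] := @pfactor_coprime 2 _ isT X0.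
set a := logn 2 _ in Xo.
have aA : (a <= A)%N.
  apply: leq_trans hA; rewrite /a lognM // -addnA leq_add2l.
  apply: leq_trans (logn2_pow_sub1_le oQ Q1 d0) _; rewrite leq_add2l ltnW //.
  by rewrite ltnNge -pfactor_dvdn.
pose g u := cos_prod R (fun t => m (a + t)%N) k u.
have Tg i : T i d <= g (o * Q ^ i %% 2 ^ k)%N.
  rewrite /T /g cos_prod_mod.
  have -> : (h * (Q ^ i * (Q ^ d).-1) = 2 ^ a * (o * Q ^ i))%N.
    by rewrite mulnCA Xo mulnC [(o * 2 ^ a)%N]mulnC mulnA.
  apply: le_trans (cos_prod_shift _ _ _ _ _).
  have -> : (l = a + k + (l - (a + k)))%N by lia.
  exact: cos_prod_trunc.
apply: (@le_trans _ _ (\sum_(i < N) g (o * Q ^ i %% 2 ^ k)%N)); first exact: ler_sum.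
have NB : N = (cc * 2 ^ c * 2 ^ (k - c))%N by rewrite -mulnA -expnD subnKC.
rewrite NB.
apply: (@le_trans _ _ ((cc * 2 ^ c)%N%:R * \sum_(u < 2 ^ k) g u)).
  apply: (@sum_spaced_le R (cc * 2 ^ c) (2 ^ (k - c)) (2 ^ k)
    (fun i => (o * Q ^ i %% 2 ^ k)%N) g) => [i|i j ij E|u].
  - by rewrite ltn_mod expn_gt0.
  - by apply: residue_spacing ij E => //; rewrite -coprime2n.
  - exact: cos_prod_ge0.
rewrite -NB /N !natrM !natrX -!mulrA ler_wpM2l // mulrCA ler_wpM2l ?exprn_ge0 //.
apply: le_trans (cos_prod_average _ _ _) _.
by rewrite ler_wpM2l ?exprn_ge0 // sA.
Qed.

Lemma pair_sum_le :
  \sum_(i < N) \sum_(d < N) T i d <= N%:R ^+ 2 * (2 ^- e + 2 ^+ c * s).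
Proof.
rewrite exchange_big /=.
apply: (@le_trans _ _ (\sum_(d < N) ((2 ^ e %| d)%N%:R * N%:R + N%:R * (2 ^+ c * s)))).
  apply: ler_sum => d _; case: (boolP (_ %| _)%N) => ed; last first.
    by rewrite mul0r add0r orbit_sum_le.
  rewrite mul1r; apply: (@le_trans _ _ (\sum_(i < N) 1)).
    by apply: ler_sum => i _; exact: cos_prod_le1.
  by rewrite sumr_const card_ord lerDl !mulr_ge0 ?exprn_ge0.
rewrite big_split /= -mulr_suml -natr_sum.
have -> : (\sum_(d < N) (2 ^ e %| d) = cc * 2 ^ (k - e))%N.
  rewrite /N (_ : cc * 2 ^ k = cc * 2 ^ (k - e) * 2 ^ e)%N; last by rewrite -mulnA -expnD subnK.
  by rewrite count_multiples ?expn_gt0.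
rewrite sumr_const card_ord -[X in _ + X]mulr_natl.
have E2 : 2 ^+ e != 0 :> R by rewrite expf_neq0.
have -> : (cc * 2 ^ (k - e))%N%:R = N%:R / 2 ^+ e :> R.
  apply: (mulIf E2); rewrite divfK // /N -{2}(subnK ek) expnD mulnA !natrM !natrX.
  by [].
by apply/le_of_eq; field.
Qed.

Lemma second_moment :
  \sum_(u < 2 ^ l) circle_sq (fun n : 'I_N =>
     2 * pi * h%:R * ((Q ^ n)%:R * ((masked m l u)%:R / 2 ^+ l))) <=
  2 ^+ l * (2 * (N%:R ^+ 2 * (2 ^- e + 2 ^+ c * s))).
Proof.
under eq_bigr do rewrite circle_sq_double.
rewrite exchange_big /=; under eq_bigr do rewrite exchange_big /=.
have bound (i j : nat) : (i <= j)%N ->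
    \sum_(u < 2 ^ l) cos (2 * pi * h%:R * ((Q ^ j)%:R * ((masked m l u)%:R / 2 ^+ l))
      - 2 * pi * h%:R * ((Q ^ i)%:R * ((masked m l u)%:R / 2 ^+ l))) <=
    2 ^+ l * T i (j - i).
  move=> ij; apply: le_trans (ler_norm _) _.
  apply: le_trans (sum_cos_masked m l (h * (Q ^ i * (Q ^ (j - i)).-1)) 0).
  apply/le_of_eq; congr `|_|; apply: eq_bigr => u _; congr cos.
  rewrite add0r -subn1 mulnBr muln1 -expnD subnKC // natrM natrB; first by ring.
  by rewrite leq_exp2l.
apply: (@le_trans _ _ (\sum_(j < N) \sum_(i < N) 2 ^+ l *
   ((i <= j)%N%:R * T i (j - i) + (j <= i)%N%:R * T j (i - j)))).
  apply: ler_sum => j _; apply: ler_sum => i _.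
  have [ij|ij] := leqP i j.
    apply: le_trans (bound _ _ ij) _.
    by rewrite ler_wpM2l ?exprn_ge0 // mul1r lerDl mulr_ge0.
  rewrite (ltnW ij) mul0r add0r mul1r; apply: le_trans (bound _ _ (ltnW ij)).
  by apply/le_of_eq/eq_bigr => u _; rewrite -cosN opprB.
under eq_bigr do rewrite -mulr_sumr.
rewrite -mulr_sumr ler_wpM2l ?exprn_ge0 //.
under eq_bigr do rewrite big_split /=.
rewrite big_split /= [X in X + _]exchange_big /=.
have H : \sum_(j < N) \sum_(i < N) (j <= i)%N%:R * T j (i - j) <=
    N%:R ^+ 2 * (2 ^- e + 2 ^+ c * s).
  apply: le_trans pair_sum_le; apply: ler_sum => j _.
  rewrite (eq_bigr (fun i : 'I_N => if (j <= i)%N then T j (i - j) else 0)) => [|i _]; last first.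
    by case: leqP; rewrite ?mul1r ?mul0r.
  rewrite -big_mkcond /= -(big_mkord (fun i => (j <= i)%N) (fun i => T j (i - j))).
  rewrite -(big_nat_widenl j 0 N xpredT) //= -{1}[val j]add0n big_addn.
  have -> : \sum_(d < N) T j d =
      \sum_(0 <= d < N - j) T j d + \sum_(N - j <= d < N) T j d.
    by rewrite -(big_mkord xpredT (T j)) -big_cat_nat ?leq_subr.
  rewrite -[leLHS]addr0 lerD ?sumr_ge0 //.
  by apply: ler_sum => i _; rewrite addnK.
by rewrite [leRHS]mulr_natl mulr2n lerD.
Qed.
End SecondMoment.

(** * Words with controlled digit counts *)

Local Open Scope nat_scope.

(** The word of [l] bits with numerator [A] is only known to be the beginning of the number of
    interest, which lies between [A / 2 ^ l] and [(A + 1) / 2 ^ l]; the two tests are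
    the possible values of its [n]-th digit in base [Q]. *)
Definition hit (Q a l A n : nat) : bool :=
  ((Q ^ n * A) %/ 2 ^ l %% Q == a) || ((Q ^ n * A.+1) %/ 2 ^ l %% Q == a).

Definition hits (m : nat -> bool) (Q a l v N : nat) : nat :=
  \sum_(n < N) hit Q a l (masked m l v) n.+1.

Definition scale (k : nat) : nat := trunc_log 2 k.

(** This many bits determine, up to the ambiguity allowed by [hit], the digits in bases less
    than [scale k] up to the index [4 * scale k * 2 ^ k]. *)
Definition len (k : nat) : nat := 8 ^ k.

(** The bound on the frequencies is [(1 + 8 / scale k) / Q], cross-multiplied so as to be tested on
    integers; it tends to [1 / Q]. The lengths [c * 2 ^ k] with [c] of the order of [scale k]
    have successive ratios close to 1, so that they control all other lengths. *)
Definition good (m : nat -> bool) (k v : nat) : bool :=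
  [forall Q : 'I_(scale k), (odd Q && (2 < Q)) ==>
    [forall a : 'I_Q, [forall c : 'I_(4 * scale k),
      hits m Q a (len k) v (c * 2 ^ k) * (Q * scale k) <=
      c * 2 ^ k * (scale k + 8)]]].

(** With [t = g %/ p.+1], the power [2 ^ g] is at least [(2 ^ t) ^ p.+1], while [g ^ p] is at most
    [(2 ^ t) ^ p] times a constant. *)
Lemma poly_le_pow2 (p C : nat) : exists G, forall g, G <= g -> C * g ^ p <= 2 ^ g.
Proof.
exists (p.+1 * (C * p.+1 ^ p)) => g Gg; pose t := g %/ p.+1.
have tC : C * p.+1 ^ p <= t by rewrite leq_divRL // mulnC.
have gt : g <= p.+1 * 2 ^ t.
  have := ltn_ceil g (ltn0Sn p); rewrite -/t => /ltnW /leq_trans; apply.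
  by rewrite mulnC leq_mul2l ltn_expl // orbT.
apply: (@leq_trans (C * (p.+1 * 2 ^ t) ^ p)); last first.
  rewrite expnMn mulnA.
  apply: (@leq_trans (2 ^ t * (2 ^ t) ^ p)).
    by rewrite leq_mul2r (leq_trans tC) ?orbT // ltnW // ltn_expl.
  by rewrite -expnS -expnM leq_exp2l // leq_divM.
rewrite leq_mul2l; apply/orP; right.
by case: (p) gt => [|q] gt //; rewrite leq_exp2r.
Qed.

Local Open Scope ring_scope.

Section Hits.
Variable R : realType.

(** The tolerance of [hit] moves the point by at most one cell of the grid with [Q * D]
    points, to the left of the digit interval. *)
Lemma hit_arc (Q a l A n D : nat) : (0 < Q)%N -> (0 < D)%N ->
  (Q ^ n * (Q * D) <= 2 ^ l)%N ->
  hit Q a l A n.+1 -> exists f : R, exists z : nat,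
    [/\ (Q ^ n)%:R * (A%:R / 2 ^+ l) = f + z%:R,
        (a * D)%:R - 1 <= f * (Q * D)%:R & f * (Q * D)%:R <= (a.+1 * D)%:R].
Proof.
move=> Q0 D0 small; set y : R := _ * _.
have QR : 0 < Q%:R :> R by rewrite ltr0n.
have DR : 0 < D%:R :> R by rewrite ltr0n.
have LR : 0 < 2 ^+ l :> R by rewrite exprn_gt0.
suff H (A' : nat) : (A <= A' <= A.+1)%N -> ((Q ^ n.+1 * A') %/ 2 ^ l %% Q = a)%N ->
    exists f : R, exists z : nat,
    [/\ y = f + z%:R, (a * D)%:R - 1 <= f * (Q * D)%:R & f * (Q * D)%:R <= (a.+1 * D)%:R].
  by case/orP => /eqP; apply: H; rewrite leqnn leqnSn.
case/andP=> AA' A'A; set w := (_ %/ _)%N => wa.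
exists (y - (w %/ Q)%N%:R), (w %/ Q)%N; rewrite subrK.
pose y' : R := (Q ^ n)%:R * (A'%:R / 2 ^+ l).
have yy' : y <= y' by rewrite /y /y' ler_wpM2l // ler_wpM2r ?invr_ge0 ?(ltW LR) // ler_nat.
have y'y : (y' - y) * (Q * D)%:R <= 1.
  rewrite /y /y' -mulrBr -mulrBl.
  have A1 : A'%:R - A%:R <= 1 :> R by rewrite lerBlDl natr1 ler_nat.
  have -> : (Q ^ n)%:R * ((A'%:R - A%:R) / 2 ^+ l) * (Q * D)%:R =
     (A'%:R - A%:R) * ((Q ^ n * (Q * D))%N%:R / 2 ^+ l) :> R.
    by rewrite [(_ ^ n * _)%N%:R]natrM; field; rewrite gt_eqF.
  rewrite -[leRHS]mulr1; apply: ler_pM => //.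
  - by rewrite subr_ge0 ler_nat.
  - by rewrite ler_pdivrMr // mul1r -natrX ler_nat.
have Qy : Q%:R * y' = (Q ^ n.+1 * A')%N%:R / 2 ^+ l.
  by rewrite /y' expnS !natrM; ring.
have wy : w%:R <= Q%:R * y'.
  rewrite Qy ler_pdivlMr // -natrX -natrM ler_nat.
  exact: leq_divM.
have yw : Q%:R * y' <= w%:R + 1.
  rewrite Qy ler_pdivrMr // natr1 -natrX -natrM ler_nat.
  by apply: ltnW; rewrite ltn_ceil // expn_gt0.
have wE : w%:R = (w %/ Q)%N%:R * Q%:R + a%:R :> R.
  by rewrite -natrM -natrD -wa -divn_eq.
rewrite !natrM in y'y *; rewrite -natr1.
move: wy yw; rewrite wE; move: (w %/ Q)%N%:R => z wy yw.
split=> //.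
- have : a%:R * D%:R <= (y' - z) * (Q%:R * D%:R).
    by rewrite mulrA ler_wpM2r ?(ltW DR) //; lra.
  by lra.
- have : (y - z) * (Q%:R * D%:R) <= (y' - z) * (Q%:R * D%:R).
    by rewrite ler_wpM2r ?mulr_ge0 ?(ltW DR) ?(ltW QR) //; lra.
  move=> /le_trans; apply; rewrite mulrA ler_wpM2r ?(ltW DR) //; lra.
Qed.

(** The grid has [g ^ 4] cells in each digit interval, and the arc used for [few_hits] extends
    it by [g ^ 3] cells on each side. The relative errors are about [2 / g] for this
    extension, [1 / g] for the exponential sums, and at most
    [M / d ^ 2 = Q / g ^ 2 <= 1 / g] for the mass of the kernel outside the arc, with
    [M = Q * g ^ 4] and [d = g ^ 3]. *)
Lemma hits_le (m : nat -> bool) (Q a l v N g : nat) :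
  (2 < Q)%N -> (Q < g)%N -> (a < Q)%N ->
  (Q ^ N * (Q * g ^ 4) <= 2 ^ l)%N ->
  (forall h : nat, (0 < h < Q * g ^ 4)%N ->
     circle_sq (fun n : 'I_N => 2 * pi * h%:R *
       ((Q ^ n)%:R * ((masked m l v)%:R / 2 ^+ l))) <=
     ((g * (Q * g ^ 4))%:R^-1 * N%:R) ^+ 2 :> R) ->
  (hits m Q a l v N * (Q * g) <= N * (g + 8))%N.
Proof.
move=> Q2 Qg aQ small W.
have g0 : (0 < g)%N by lia.
have D0 : (0 < g ^ 4)%N by rewrite expn_gt0 g0.
have g3 : (0 < g ^ 3)%N by rewrite expn_gt0 g0.
have gR : 4 <= g%:R :> R by rewrite ler_nat; lia.
have QR : 3 <= Q%:R :> R by rewrite ler_nat.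
have QgR : Q%:R <= g%:R :> R by rewrite ler_nat ltnW.
have M1 : (g ^ 3 + 1 <= Q * g ^ 4)%N by rewrite expnS; nia.
(* [Q * g ^ 4] is added to the left end, a full turn, to keep it a natural number. *)
have := @few_hits R N (Q * g ^ 4) (a * g ^ 4 + Q * g ^ 4 - 1 - g ^ 3) (g ^ 4 + 1 + 2 * g ^ 3)
  (g ^ 3) (g * (Q * g ^ 4))%:R^-1
  (fun n => (Q ^ n)%:R * ((masked m l v)%:R / 2 ^+ l))
  (fun n => hit Q a l (masked m l v) n.+1) g3.
have cM : (g ^ 4 + 1 + 2 * g ^ 3 <= Q * g ^ 4)%N by rewrite expnS; nia.
have M0 : (0 < Q * g ^ 4)%N by lia.
move=> /(_ M0 cM); rewrite invr_ge0 ler0n => /(_ isT W) H.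
have sE : (a * g ^ 4 + Q * g ^ 4 - 1 - g ^ 3)%N%:R =
    a%:R * g%:R ^+ 4 + Q%:R * g%:R ^+ 4 - 1 - g%:R ^+ 3 :> R.
  by rewrite !natrB ?natrD ?natrM ?natrX //; lia.
move: H; rewrite sE => H.
have {}H : (hits m Q a l v N)%:R * ((Q * g ^ 4)%:R - (Q * g ^ 4)%:R ^+ 2 / (g ^ 3)%:R ^+ 2) <=
   (g ^ 4 + 1 + 2 * g ^ 3)%:R * (1 + (Q * g ^ 4)%:R / (g * (Q * g ^ 4))%:R) * N%:R :> R.
  have Q0 : (0 < Q)%N by lia.
  apply: H => n; have sn : (Q ^ n * (Q * g ^ 4) <= 2 ^ l)%N.
    by apply: leq_trans small; rewrite leq_mul2r leq_exp2l ?(ltnW (ltn_ord n)) ?orbT //; lia.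
  move=> /(hit_arc Q0 D0 sn) [f [z [E1 E2 E3]]].
  exists (f + 1), 1, z; split; first by rewrite E1; ring.
  - by move: E2; rewrite !natrM ?natrX; lra.
  - by move: E3; rewrite -addn1 !natrM !natrD !natrM ?natrX; lra.
rewrite -(ler_nat R) !natrM natrD; move: H; rewrite !natrD !natrM ?natrX.
move: (ler0n R (hits m Q a l v N)) (ler0n R N); move: (hits _ _ _ _ _ _)%:R N%:R => x n x0 n0.
move: QgR gR QR; move: g%:R Q%:R => G q QG G4 q3.
have G0 : 0 < G by lra.
have -> : (q * G ^+ 4) ^+ 2 / (G ^+ 3) ^+ 2 = q ^+ 2 * G ^+ 2.
  by field; lra.
have -> : q * G ^+ 4 / (G * (q * G ^+ 4)) = G^-1 by field; apply/andP; split; lra.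
move=> H.
have H1 : x * (q * G ^+ 3 * (G - 1)) <= x * (q * G ^+ 4 - q ^+ 2 * G ^+ 2).
  apply: ler_wpM2l => //; rewrite -subr_ge0.
  have -> : q * G ^+ 4 - q ^+ 2 * G ^+ 2 - q * G ^+ 3 * (G - 1) =
    q * G ^+ 2 * (G - q) by ring.
  by rewrite !mulr_ge0 ?subr_ge0 ?exprn_ge0 //; lra.
have H2 : G * (x * (q * G ^+ 3 * (G - 1))) <=
    (G ^+ 4 + 1 + 2 * G ^+ 3) * (G + 1) * n.
  have -> : (G ^+ 4 + 1 + 2 * G ^+ 3) * (G + 1) * n =
     G * ((G ^+ 4 + 1 + 2 * G ^+ 3) * (1 + G^-1) * n) by field; lra.
  by apply: ler_wpM2l; lra.
have H3 : (G ^+ 4 + 1 + 2 * G ^+ 3) * (G + 1) <= G ^+ 3 * (G - 1) * (G + 8).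
  rewrite -subr_ge0.
  have -> : G ^+ 3 * (G - 1) * (G + 8) - (G ^+ 4 + 1 + 2 * G ^+ 3) * (G + 1) =
    G ^+ 3 * (4 * (G - 4)) + 6 * (G ^+ 3 - 4 ^+ 3) + (384 - 1 - 4) - (G - 4) by ring.
  have G3 : 4 ^+ 3 <= G ^+ 3 by rewrite lerXn2r ?nnegrE //; lra.
  have : 4 ^+ 3 * (4 * (G - 4)) <= G ^+ 3 * (4 * (G - 4)).
    by apply: ler_wpM2r => //; lra.
  lra.
have H4 : (G ^+ 4 + 1 + 2 * G ^+ 3) * (G + 1) * n <= G ^+ 3 * (G - 1) * (G + 8) * n.
  exact: ler_wpM2r.
have P0 : 0 < G ^+ 3 * (G - 1) by rewrite mulr_gt0 ?exprn_gt0 //; lra.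
rewrite -(ler_pM2l P0); apply: le_trans (le_trans _ H4) _; last first.
  by apply/le_of_eq; ring.
by apply: le_trans H2; apply/le_of_eq; ring.
Qed.
End Hits.

(** * The density of badly behaved words *)

Lemma term_le_sum (R : numDomainType) (I : finType) (F : I -> R) i :
  (forall j, 0 <= F j) -> F i <= \sum_j F j.
Proof. by move=> F0; rewrite (bigD1 i) //= lerDl sumr_ge0. Qed.

(** Chebyshev's inequality. A word that is not good has, by [hits_le], a large exponential sum
    for some base [Q], some length [c * 2 ^ k] and some frequency [h]; the
    corresponding [weight], the square of the sum divided by the square of the threshold, is then
    at least 1. *)
Section BadSets.
Variable R : realType.
Variables (m : nat -> bool) (k : nat).
Let g := scale k.
Let l := len k.
Hypothesis g7 : (g ^ 7 <= 2 ^ g)%N.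
Hypothesis gk : (4 * g <= k)%N.
Hypothesis lk : (5 * g + k <= l)%N.
Hypothesis small : forall Q N : nat, (Q < g)%N -> (N <= 4 * g * 2 ^ k)%N ->
  (Q ^ N * (Q * g ^ 4) <= 2 ^ l)%N.
Hypothesis dense : forall a : nat, (a <= 5 * g)%N ->
  (12 * g <= \sum_(t < k) m (a + t))%N.

Let weight (Q c h v : nat) : R :=
  if [&& odd Q, (2 < Q)%N, (0 < c)%N, (0 < h)%N & (h < Q * g ^ 4)%N] then
    circle_sq (fun n : 'I_(c * 2 ^ k) => 2 * pi * h%:R *
       ((Q ^ n)%:R * ((masked m l v)%:R / 2 ^+ l))) *
    ((g * (Q * g ^ 4))%:R / (c * 2 ^ k)%:R) ^+ 2
  else 0.

Let weight_ge0 Q c h v : 0 <= weight Q c h v.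
Proof. by rewrite /weight; case: ifP => // _; rewrite mulr_ge0 ?circle_sq_ge0 ?sqr_ge0. Qed.

Lemma sqrt2_pow (n : nat) : (Num.sqrt 2)^-1 ^+ (12 * n) = 2 ^- (6 * n) :> R.
Proof.
have -> : (12 * n = 2 * (6 * n))%N by lia.
by rewrite exprM exprVn sqr_sqrtr // exprVn.
Qed.

(** The choices [e = 4 g] and [A = 5 g] in [second_moment] are possible because
    [Q ^ 2], and [h] when the weight is not zero, are bounded by powers of [g]. *)
Lemma weight_mean Q c h : (Q < g)%N ->
  \sum_(v < 2 ^ l) weight Q c h v <= 2 ^+ l * (4 * 2 ^- (4 * g) * g%:R ^+ 12).
Proof.
move=> Qg.
have [C|/negPf C] := boolP [&& odd Q, (2 < Q)%N, (0 < c)%N, (0 < h)%N & (h < Q * g ^ 4)%N]; last first.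
  rewrite big1 => [|v _]; last by rewrite /weight C.
  by rewrite !(mulr_ge0, exprn_ge0, invr_ge0).
under eq_bigr do rewrite /weight C.
case/and5P: C => oQ Q2 c0 h0 hM; rewrite -mulr_suml.
set N := (c * 2 ^ k)%N; set M := (Q * g ^ 4)%N in hM *.
have N0 : (0 < N)%N by rewrite muln_gt0 c0 expn_gt0.
have NR : 0 < N%:R :> R by rewrite ltr0n.
have M5 : (M <= g ^ 5)%N by rewrite expnS leq_mul2r (ltnW Qg) orbT.
set c1 := logn 2 (Q ^ 2).-1.
have Q2' : (0 < (Q ^ 2).-1)%N by nia.
have hc : (2 ^ (logn 2 h + c1) <= 2 ^ g)%N.
  apply: leq_trans g7; rewrite (expnD g 5 2) expnD leq_mul //.
    by apply: leq_trans (leq_trans (ltnW hM) M5); rewrite dvdn_leq // pfactor_dvdnn.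
  apply: (@leq_trans (Q ^ 2).-1); first by rewrite dvdn_leq // pfactor_dvdnn.
  by nia.
have hc' : (logn 2 h + c1 <= g)%N by rewrite leq_exp2l in hc.
have V := @second_moment R m l Q h k (4 * g) c (5 * g) (2 ^- (6 * g)) oQ (ltnW Q2) h0.
have {}V := V _ gk _ lk _.
apply: (@le_trans _ _ (2 ^+ l * (2 * (N%:R ^+ 2 * (2 ^- (4 * g) + 2 ^+ c1 * 2 ^- (6 * g)))) *
   ((g * M)%:R / N%:R) ^+ 2)).
  apply: ler_wpM2r; first exact: sqr_ge0.
  apply: V; [by lia | by rewrite -/c1; lia |] => a aA.
  rewrite -sqrt2_pow; apply: ler_wiXn2l; last exact: dense.
    by rewrite invr_ge0 sqrtr_ge0.
  have s1 : 1 <= Num.sqrt 2 :> R by rewrite -{1}(sqrtr1 R) ler_sqrt; lra.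
  by rewrite invf_le1 //; lra.
have E (x y n : R) : 0 < n -> 2 * (n ^+ 2 * x) * (y / n) ^+ 2 = 2 * x * y ^+ 2.
  by move=> n0; field; lra.
rewrite -mulrA E //.
rewrite ler_wpM2l ?exprn_ge0 //; apply: ler_pM.
- by rewrite mulr_ge0 // addr_ge0 ?mulr_ge0 ?invr_ge0 ?exprn_ge0.
- exact: sqr_ge0.
- have -> : 4 * 2 ^- (4 * g) = 2 * (2 ^- (4 * g) + 2 ^+ (2 * g) * 2 ^- (6 * g)) :> R.
    have -> : (6 * g = 2 * g + 4 * g)%N by lia.
    by rewrite exprD; field; rewrite !expf_neq0.
  rewrite ler_wpM2l // lerD2l ler_wpM2r ?invr_ge0 ?exprn_ge0 //.
  by rewrite ler_eXn2l ?ltr1n //; lia.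
- rewrite -!natrX ler_nat (_ : 12 = 6 * 2)%N // expnM leq_exp2r //.
  by rewrite expnS leq_mul2l M5 orbT.
Qed.

Lemma bad_le_weight (v : nat) : (~~ good m k v)%:R <=
  \sum_(Q < g) \sum_(c < 4 * g) \sum_(h < g ^ 5) weight Q c h v.
Proof.
case: (boolP (good m k v)) => [_|].
  by rewrite !sumr_ge0 // => Q _; rewrite sumr_ge0 // => c _; rewrite sumr_ge0.
rewrite /good => /forallPn[Q]; rewrite negb_imply => /andP[/andP[oQ Q2]].
move=> /forallPn[a] /forallPn[c]; rewrite -/g -/l => bad.
have Qg : (Q < g)%N by [].
have c0 : (0 < c)%N.
  rewrite lt0n; apply: contraNN bad => /eqP ->.
  by rewrite !mul0n /hits big_ord0 mul0n.
set N := (c * 2 ^ k)%N in bad *.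
have N0 : (0 < N)%N by rewrite muln_gt0 c0 expn_gt0.
have NR : 0 < N%:R :> R by rewrite ltr0n.
have gM0 : (0 < g * (Q * g ^ 4))%N by rewrite !muln_gt0; lia.
have [h hM hW] : exists2 h : nat, (0 < h < Q * g ^ 4)%N &
    ((g * (Q * g ^ 4))%:R^-1 * N%:R) ^+ 2 <
    circle_sq (fun n : 'I_N => 2 * pi * h%:R *
       ((Q ^ n)%:R * ((masked m l v)%:R / 2 ^+ l))) :> R.
  apply: contrapT => none; move/negP: bad; apply.
  apply: (@hits_le R) => //; first by apply: small => //; rewrite leq_mul2r (ltnW (ltn_ord c)) orbT.
  move=> h hM; rewrite leNgt; apply/negP => W; apply: none.
  by exists h.
have h5 : (h < g ^ 5)%N.
  case/andP: hM => _ /leq_trans; apply; rewrite expnS leq_mul2r (ltnW Qg) orbT //.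
apply: (@le_trans _ _ (weight Q c h v)).
  rewrite /weight oQ Q2 c0 (andP hM).1 (andP hM).2 /=.
  have gR : 0 < (g * (Q * g ^ 4))%:R :> R by rewrite ltr0n.
  move: hW; rewrite -/N; set C := circle_sq _.
  set x := (_ * (_ * _))%:R in gR * => hW.
  have E (y z : R) : 0 < y -> 0 < z -> (y^-1 * z) ^+ 2 * (y / z) ^+ 2 = 1.
    by move=> y0 z0; field; apply/andP; split; lra.
  apply: (@le_trans _ _ ((x^-1 * N%:R) ^+ 2 * (x / N%:R) ^+ 2)); first by rewrite E.
  by rewrite ler_wpM2r ?sqr_ge0 // ltW.
apply: (le_trans (@term_le_sum R _ (fun i : 'I_(g ^ 5) => weight Q c i v) (Ordinal h5) _)) => //=.
apply: (le_trans (@term_le_sum R _ (fun i : 'I_(4 * g) => \sum_(h < g ^ 5) weight Q i h v) c _)) => //=.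
  by move=> j; rewrite sumr_ge0.
apply: (@term_le_sum R _ (fun i : 'I_g => \sum_(c < 4 * g) \sum_(h < g ^ 5) weight i c h v)) => //=.
by move=> j; rewrite sumr_ge0 // => i _; rewrite sumr_ge0.
Qed.

Lemma bad_count : (0 < k)%N -> (64 * g ^ 19 <= 2 ^ (2 * g))%N ->
  (k * k.+1 * \sum_(v < 2 ^ l) ~~ good m k v <= 2 ^ l)%N.
Proof.
move=> k0 g19.
have H : (\sum_(v < 2 ^ l) ~~ good m k v)%N%:R <=
    2 ^+ l * (16 * g%:R ^+ 19 * 2 ^- (4 * g)) :> R.
  rewrite natr_sum; apply: (@le_trans _ _ (\sum_(v < 2 ^ l)
     \sum_(Q < g) \sum_(c < 4 * g) \sum_(h < g ^ 5) weight Q c h v)).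
    by apply: ler_sum => v _; exact: bad_le_weight.
  rewrite exchange_big /=.
  apply: (@le_trans _ _ (\sum_(Q < g) \sum_(c < 4 * g) \sum_(h < g ^ 5)
     2 ^+ l * (4 * 2 ^- (4 * g) * g%:R ^+ 12))).
    apply: ler_sum => Q _; rewrite exchange_big /=; apply: ler_sum => c _.
    by rewrite exchange_big /=; apply: ler_sum => h _; exact: weight_mean.
  rewrite !sumr_const !card_ord -!mulrnA -[leLHS]mulr_natr.
  rewrite (_ : (g ^ 5 * (4 * g * g) = 4 * g ^ 7)%N); last by ring.
  by rewrite natrM natrX; apply/le_of_eq; ring.
have g2 : (k * k.+1 <= 4 * 2 ^ (2 * g))%N.
  have /andP[_ kg] := @trunc_log_bounds 2 k isT k0.
  have -> : (4 * 2 ^ (2 * g) = 2 ^ g.+1 * 2 ^ g.+1)%N.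
    by rewrite !expnS mul2n -addnn expnD; ring.
  by rewrite leq_mul // ltnW.
rewrite -(ler_nat R) natrM natrX.
apply: (@le_trans _ _ ((4 * 2 ^+ (2 * g)) * (2 ^+ l * (16 * g%:R ^+ 19 * 2 ^- (4 * g))))).
  apply: ler_pM => //.
  by rewrite -natrX -natrM ler_nat.
have -> : 4 * 2 ^+ (2 * g) * (2 ^+ l * (16 * g%:R ^+ 19 * 2 ^- (4 * g))) =
    2 ^+ l * ((64 * g ^ 19)%N%:R / 2 ^+ (2 * g)) :> R.
  have -> : (4 * g = 2 * g + 2 * g)%N by lia.
  by rewrite exprD natrM natrX; field; rewrite expf_neq0.
rewrite -[leRHS]mulr1 ler_wpM2l ?exprn_ge0 // ler_pdivrMr ?exprn_gt0 // mul1r.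
by rewrite -natrX ler_nat.
Qed.
End BadSets.

Lemma scale_unbounded G : exists K, forall k, (K <= k)%N -> (G <= scale k)%N.
Proof.
exists (2 ^ G)%N => k Gk; rewrite /scale -(trunc_expnK G (isT : (1 < 2)%N)).
exact: leq_trunc_log.
Qed.

Lemma len_large : exists K, forall k, (K <= k)%N -> forall Q N,
  (Q < scale k)%N -> (N <= 4 * scale k * 2 ^ k)%N ->
  (Q ^ N * (Q * scale k ^ 4) <= 2 ^ len k)%N.
Proof.
have [G1 G1P] := poly_le_pow2 1 4.
have [K2 K2P] := poly_le_pow2 2 20.
have [K3 K3P] := scale_unbounded G1.
exists (K2 + K3 + 1)%N => k kK Q N Qg N4.
have gk : (G1 <= scale k)%N by apply: K3P; lia.
have k0 : (0 < k)%N by lia.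
have /andP[kg _] := @trunc_log_bounds 2 k isT k0.
have g4 : (4 * scale k <= k)%N.
  by apply: leq_trans kg; rewrite -[(4 * _)%N in leqLHS]/(4 * scale k ^ 1)%N G1P.
have k20 : (20 * k ^ 2 <= 2 ^ k)%N by apply: K2P; lia.
have lE : (len k = 2 ^ k * (2 ^ k * 2 ^ k))%N.
  by rewrite /len -!expnD -(expnM 2 3); congr (_ ^ _)%N; lia.
have x0 : (0 < 2 ^ k)%N by rewrite expn_gt0.
have Q2 : (Q <= 2 ^ scale k)%N by apply: leq_trans (ltnW (ltn_expl _ _)); lia.
have g2 : (scale k <= 2 ^ scale k)%N by exact: ltnW (ltn_expl _ _).
apply: (@leq_trans ((2 ^ scale k) ^ N * (2 ^ scale k * (2 ^ scale k) ^ 4)))%N.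
  apply: leq_mul; first by case: N N4 => // n _; rewrite leq_exp2r.
  by apply: leq_mul => //; rewrite leq_exp2r.
rewrite -expnS -expnD -expnM leq_exp2l // lE.
apply: (@leq_trans (scale k * (4 * scale k * 2 ^ k + 5)))%N.
  by rewrite leq_mul2l leq_add2r N4 orbT.
move: (scale k) (2 ^ k)%N g4 x0 k20 => y x yk x0 xk.
apply: (@leq_trans (20 * k ^ 2 * x)%N).
  have yy : (y * y <= k * k)%N by rewrite leq_mul; lia.
  have yyx : (y * y * x <= k * k * x)%N by rewrite leq_mul2r yy orbT.
  by nia.
apply: (@leq_trans (x * x)%N); first by rewrite leq_mul2r xk orbT.
by rewrite leq_mul2l leq_pmulr ?orbT.
Qed.

Lemma good_almost_all (R : realType) (m : nat -> bool) :
  (exists K, forall k, (K <= k)%N -> forall a, (a <= 5 * scale k)%N ->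
     (12 * scale k <= \sum_(t < k) m (a + t))%N) ->
  exists k0, forall k, (k0 <= k)%N ->
    (k * k.+1 * \sum_(v < 2 ^ len k) ~~ good m k v <= 2 ^ len k)%N.
Proof.
case=> K dense.
have [G7 G7P] := poly_le_pow2 7 1.
have [G1 G1P] := poly_le_pow2 1 4.
have [G19 G19P] := poly_le_pow2 19 64.
have [K2 K2P] := len_large.
have [K3 K3P] := scale_unbounded (G7 + G1 + G19).
exists (K + K2 + K3 + 1)%N => k kK.
have gk : (G7 + G1 + G19 <= scale k)%N by apply: K3P; lia.
have k0 : (0 < k)%N by lia.
have /andP[kg _] := @trunc_log_bounds 2 k isT k0.
have g4 : (4 * scale k <= k)%N.
  by apply: leq_trans kg; rewrite -[(4 * _)%N in leqLHS]/(4 * scale k ^ 1)%N G1P //; lia.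
apply: (@bad_count R) => //.
- by rewrite -[leqLHS]mul1n G7P //; lia.
- apply: (@leq_trans (8 * k)%N); first by lia.
  by rewrite /len; case: (k) k0 => // n _; rewrite expnS leq_mul2l /= ltn_expl.
- by move=> Q N; apply: K2P; lia.
- by apply: dense; lia.
- by apply: leq_trans (G19P _ _) _; [lia | rewrite leq_exp2l //; lia].
Qed.

(** * Sparse sets *)

Local Open Scope classical_set_scope.
Local Open Scope ring_scope.

Definition allowed (S : set nat) (i : nat) : bool := i.+1 \in S.

Lemma limn_einf_gt (R : realType) (u : (\bar R)^nat) (y : \bar R) :
  (y < limn_einf u)%E -> exists n, forall k, (n <= k)%N -> (y < u k)%E.
Proof.
rewrite limn_einf_lim => yu.
have E : limn (einfs u) = ereal_sup (range (einfs u)).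
  by apply/cvg_lim => //; exact: cvg_einfs_sup.
move: yu; rewrite E => /ereal_sup_gt[_ [n _ <-] yn].
exists n => k nk; apply: lt_le_trans yn _.
by apply: ereal_inf_lbound; exists k.
Qed.

Lemma cardS_le_allowed (S : set nat) a k :
  (cardS S a (a + k) <= 1 + \sum_(t < k) allowed S (a + t))%N.
Proof.
rewrite /cardS -sum1_count big_mkcond /= big_ltn ?ltnS ?leq_addr //=.
apply: leq_add; first by case: ifP.
rewrite -{1}[a.+1]add0n big_addn subSS addKn big_mkord.
by apply: leq_sum => i _; rewrite /allowed addnS addnC; case: (_ \in _).
Qed.

Lemma ln2_ge (R : realType) : 1 / 2 <= ln (2 : R).
Proof.
have := @le_ln1Dx R (- (1 / 2)).
have -> : 1 + - (1 / 2) = 2^-1 :> R by field.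
rewrite lnV ?posrE //; lra.
Qed.

(** A power of [k] beats the logarithm of [k], so that the sparsity condition covers all the
    starting points [a] up to [5 * scale k]. *)
Lemma powR_scale (R : realType) (rho : R) : 0 < rho ->
  exists K, forall k, (K <= k)%N -> (5 * scale k)%:R <= k%:R `^ rho.
Proof.
move=> rho0; pose n := (Num.truncn (rho^-1)).+1.
have nrho : (n%:R)^-1 <= rho :> R.
  by rewrite -[leRHS]invrK lef_pV2 ?posrE ?invr_gt0 // ltW // truncnS_gt.
have [G GP] := poly_le_pow2 n (5 ^ n).
have [K KP] := scale_unbounded G.
exists K.+1 => k Kk; have k0 : (0 < k)%N by lia.
have /andP[kg _] := @trunc_log_bounds 2 k isT k0.
have k1 : 1 <= k%:R :> R by rewrite ler1n.
apply: (@le_trans _ _ (k%:R `^ n%:R^-1)); last exact: ler_powR.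
have n0 : n%:R != 0 :> R by rewrite pnatr_eq0.
have -> : (5 * scale k)%:R = ((5 * scale k) ^ n)%N%:R `^ n%:R^-1 :> R.
  by rewrite natrX -powR_mulrn // -powRrM mulfV // powRr1.
apply: ge0_ler_powR; rewrite ?nnegrE // ler_nat.
by rewrite expnMn (leq_trans (GP _ _)) // KP //; lia.
Qed.

(** Since [ln 2 >= 1 / 2], the bound [30 ln k] is at least [15 * scale k]. *)
Lemma sparse_dense (R : realType) (S : set nat) (rho : R) :
  sparsity_exponent S rho ->
  exists K, forall k, (K <= k)%N -> forall a, (a <= 5 * scale k)%N ->
     (12 * scale k <= \sum_(t < k) allowed S (a + t))%N.
Proof.
case=> rho0 /limn_einf_gt[K1 K1P].
have [K2 K2P] := powR_scale rho0.
have [K3 K3P] := scale_unbounded 1.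
exists (K1 + K2 + K3 + 2)%N => k kK a ak.
have k0 : (0 < k)%N by lia.
have /andP[kg _] := @trunc_log_bounds 2 k isT k0.
have lnk : (scale k)%:R / 2 <= ln k%:R :> R.
  apply: (@le_trans _ _ (ln (2 ^ scale k)%N%:R)).
    rewrite natrX lnXn // -[leRHS]mulr_natl ler_wpM2l //.
    by have := ln2_ge R; lra.
  by rewrite ler_ln ?posrE ?ltr0n ?expn_gt0 // ler_nat.
have g1 : 1 <= (scale k)%:R :> R by rewrite ler1n K3P //; lia.
have := K1P k; rewrite lte_fin => /(_ _)/lt_le_trans H.
have : 1 < (cardS S a (a + k))%:R / (30 * ln k%:R) :> R.
  apply: H; first by lia.
  apply: (@bigmin_inf_seq _ _ _ _ _ a) => //.
  rewrite mem_index_iota /= ltnS truncn_ge_nat ?powR_ge0 //.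
  apply: le_trans (K2P k _); last by lia.
  by rewrite ler_nat.
rewrite ltr_pdivlMr ?mul1r; last by lra.
have C : (cardS S a (a + k))%:R <= 1 + (\sum_(t < k) allowed S (a + t))%N%:R :> R.
  by rewrite addrC natr1 ler_nat -add1n cardS_le_allowed.
move=> H2; have {}H2 : (15 * scale k)%N%:R < 1 + (\sum_(t < k) allowed S (a + t))%N%:R :> R.
  by rewrite natrM; lra.
by move: H2; rewrite addrC natr1 ltr_nat; lia.
Qed.

(** * Digit expansions and simple normality *)

Lemma cvg_within_pow (R : realType) (b : nat) (u : nat -> R) (x : R) :
  (1 < b)%N -> (forall n, u n <= x <= u n + b%:R ^- n) -> u n @[n --> \oo] --> x.
Proof.
move=> b1 H.
have b0 : 0 < b%:R :> R by rewrite ltr0n; lia.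
have Z : (x - b%:R ^- n) @[n --> \oo] --> x.
  rewrite -[X in _ --> X]subr0; apply: cvgB; first exact: cvg_cst.
  have -> : (fun n => b%:R ^- n) = (fun n => b%:R^-1 ^+ n) :> (nat -> R).
    by apply/funext => n; rewrite exprVn.
  apply: cvg_expr; rewrite ger0_norm ?invr_ge0 ?(ltW b0) //.
  by rewrite invf_lt1 // ltr1n.
apply: (squeeze_cvgr _ Z (cvg_cst x)).
by apply: nearW => n; have := H n; lra.
Qed.

Section Digits.
Variables (R : realType) (q : nat) (x : R).
Hypotheses (q1 : (1 < q)%N) (x01 : 0 <= x < 1).

Definition digit (j : nat) : nat := (Num.truncn (q%:R ^+ j * x) %% q)%N.

Let q0 : 0 < q%:R :> R. Proof. by rewrite ltr0n; lia. Qed.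
Let x0 : 0 <= x. Proof. by case/andP: x01. Qed.
Let qx j : 0 <= q%:R ^+ j * x. Proof. by rewrite mulr_ge0 ?exprn_ge0 // ltW. Qed.

Lemma truncn_divn j :
  (Num.truncn (q%:R ^+ j.+1 * x) %/ q = Num.truncn (q%:R ^+ j * x))%N.
Proof.
have /andP[w1 w2] := truncn_itv (qx j.+1).
move: w1 w2; set w := Num.truncn _; rewrite exprS -mulrA => w1 w2.
apply/esym/truncn_def/andP; split.
  rewrite -(ler_pM2l q0); apply: le_trans w1.
  by rewrite -natrM mulnC ler_nat leq_divM.
rewrite -(ltr_pM2l q0); apply: lt_le_trans w2 _.
by rewrite -natrM ler_nat mulnC ltn_ceil //; lia.
Qed.

Lemma sum_digits n : \sum_(1 <= j < n.+1) (digit j)%:R / q%:R ^+ j =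
  (Num.truncn (q%:R ^+ n * x))%:R / q%:R ^+ n :> R.
Proof.
elim: n => [|n IH].
  by rewrite big_geq // expr0 mul1r (@truncn_def _ _ 0) ?mul0r // mulr0n.
rewrite big_nat_recr //= IH [in RHS](divn_eq (Num.truncn _) q) truncn_divn -/(digit _).
by rewrite natrD natrM exprS; field; rewrite expf_neq0 // gt_eqF.
Qed.

(** If all digits after the [N]-th one were maximal, then the distance from [q ^ N x] to the
    next integer would be at most [q ^ - n] for every [n]. *)
Lemma digit_not_eventually_max N : ~ (forall j, (N <= j)%N -> digit j = q.-1).
Proof.
move=> H; pose w j := Num.truncn (q%:R ^+ j * x).
have wS j : (N <= j)%N -> ((w j.+1).+1 = q * (w j).+1)%N.
  move=> Nj; have := H j.+1 (leq_trans Nj (leqnSn _)); rewrite /digit -/(w _) => d.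
  by rewrite (divn_eq (w j.+1) q) truncn_divn d /w; lia.
have wn n : ((w (N + n)).+1 = q ^ n * (w N).+1)%N.
  elim: n => [|n IH]; first by rewrite addn0 mul1n.
  by rewrite addnS wS ?leq_addr // IH expnS mulnA.
have /andP[_ gap] := truncn_itv (qx N); rewrite -/(w N) in gap.
pose d := (w N).+1%:R - q%:R ^+ N * x.
have d0 : 0 < d by rewrite subr_gt0.
have dn (n : nat) : q%:R ^+ n * d <= 1.
  have /andP[lo _] := truncn_itv (qx (N + n)); rewrite -/(w _) in lo.
  rewrite /d mulrBr mulrA -exprD addnC -natrX -natrM -wn -natr1; lra.
pose n := (Num.truncn d^-1).+1.
have nd : 1 < n%:R * d.
  by rewrite -ltr_pdivrMr // mul1r truncnS_gt.
have := dn n; apply/negP; rewrite -ltNge; apply: lt_le_trans nd _.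
by rewrite ler_wpM2r ?(ltW d0) // -natrX ler_nat ltnW // ltn_expl.
Qed.

Lemma digit_expansion : is_expansion q x digit.
Proof.
have fx : Num.floor x = 0 by apply/eqP; rewrite floor_eq /= mulr0z.
split=> [j _||[N]]; last exact: digit_not_eventually_max.
  by rewrite ltn_mod; lia.
rewrite fx subr0; apply: (@cvg_within_pow _ q) => // n.
rewrite sum_digits; have /andP[w1 w2] := truncn_itv (qx n).
have qn : 0 < q%:R ^+ n :> R by rewrite exprn_gt0.
rewrite ler_pdivrMr // [x * _]mulrC w1 /=.
rewrite -[X in _ <= _ + X]mul1r -mulrDl ler_pdivlMr // mulrC natr1.
exact: ltW.
Qed.

(** The two candidates of [hit] bracket the true digit and come from integer parts that
    differ by at most one. *)
Lemma hit_digit (l A j : nat) :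
  A%:R / 2 ^+ l <= x <= A%:R / 2 ^+ l + 2 ^- l -> (q ^ j <= 2 ^ l)%N ->
  hit q (digit j) l A j.
Proof.
case/andP=> Ax xA qj; have L0 : 0 < 2 ^+ l :> R by rewrite exprn_gt0.
have Lnat : (0 < 2 ^ l)%N by rewrite expn_gt0.
have /andP[w1 w2] := truncn_itv (qx j).
have qj0 : 0 <= q%:R ^+ j :> R by rewrite exprn_ge0 // ltW.
set w := Num.truncn _ in w1 w2.
have lo : ((q ^ j * A) %/ 2 ^ l <= w)%N.
  rewrite /w truncn_ge_nat //; apply: (@le_trans _ _ (q%:R ^+ j * (A%:R / 2 ^+ l))).
    rewrite mulrA ler_pdivlMr // -natrX -natrM -natrX -natrM ler_nat.
    exact: leq_divM.
  by rewrite ler_wpM2l.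
have hi : (w <= (q ^ j * A.+1) %/ 2 ^ l)%N.
  rewrite leq_divRL // -(ler_nat R) !natrM !natrX -ler_pdivlMr //.
  apply: le_trans w1 _; rewrite -mulrA ler_wpM2l // -natr1 mulrDl mul1r.
  exact: xA.
have hi2 : ((q ^ j * A.+1) %/ 2 ^ l <= ((q ^ j * A) %/ 2 ^ l).+1)%N.
  rewrite -ltnS ltn_divLR // mulnS.
  have := ltn_ceil (q ^ j * A) Lnat; rewrite [((_ %/ _).+2 * _)%N]mulSn; lia.
rewrite /hit /digit -/w.
have [->|ne] := eqVneq w ((q ^ j * A) %/ 2 ^ l)%N; first by rewrite eqxx.
by rewrite (_ : w = (q ^ j * A.+1) %/ 2 ^ l)%N ?eqxx ?orbT //; lia.
Qed.

Definition digit_count (a N : nat) : nat := (\sum_(i < N) (digit i.+1 == a))%N.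

Lemma digit_countE a N :
  count (fun j => digit j == a) (index_iota 1 N.+1) = digit_count a N.
Proof.
rewrite -sum1_count big_mkcond /= big_add1 /= big_mkord.
by apply: eq_bigr => i _; case: (_ == _).
Qed.

Lemma digit_count_homo a : {homo digit_count a : M N / (M <= N)%N}.
Proof.
move=> M N MN; rewrite /digit_count -(subnKC MN) big_split_ord /=.
exact: leq_addr.
Qed.

Lemma sum_digit_count N : (\sum_(a < q) digit_count a N = N)%N.
Proof.
rewrite exchange_big /= (eq_bigr (fun=> 1%N)) => [|i _].
  by rewrite sum_nat_const card_ord muln1.
have dq : (digit i.+1 < q)%N by rewrite ltn_mod; lia.
rewrite (bigD1 (Ordinal dq)) //= eqxx big1 // => j /negPf.
by rewrite -val_eqE /= eq_sym => ->.
Qed.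

(** Frequencies sum to 1, so an asymptotic upper bound [1 / q] for all of them is also
    a lower bound for each. *)
Lemma simply_normal_of_upper :
  (forall e : R, 0 < e -> exists N0, forall N a, (N0 <= N)%N -> (a < q)%N ->
     (digit_count a N)%:R <= N%:R * (q%:R^-1 + e)) ->
  simply_normal_in_base q x.
Proof.
move=> U; exists digit; first exact: digit_expansion.
move=> a aq; apply/cvgrPdist_le => e e0.
have [N0 HN] := U (e / q%:R) (divr_gt0 e0 q0).
near=> N.
have NN0 : (N0 <= N)%N by near: N; exact: nbhs_infty_ge.
have N1 : (0 < N)%N by near: N; exact: nbhs_infty_gt.
have NR : 0 < N%:R :> R by rewrite ltr0n.
have eq1 : e / q%:R <= e by rewrite ler_pdivrMr // ler_peMr ?(ltW e0) // ler1n; lia.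
rewrite digit_countE ler_distl; apply/andP; split.
  rewrite lerBlDr ler_pdivrMr //.
  by have := HN N a NN0 aq; rewrite mulrDr; nra.
rewrite -lerBlDr ler_pdivlMr //.
have S : N%:R = (digit_count a N)%:R + \sum_(i < q | i != Ordinal aq) (digit_count i N)%:R :> R.
  by rewrite -{1}(sum_digit_count N) natr_sum (bigD1 (Ordinal aq)).
have B : \sum_(i < q | i != Ordinal aq) (digit_count i N)%:R <=
    q.-1%:R * (N%:R * (q%:R^-1 + e / q%:R)) :> R.
  apply: (@le_trans _ _ (\sum_(i < q | i != Ordinal aq) N%:R * (q%:R^-1 + e / q%:R))).
    by apply: ler_sum => i _; exact: HN.
  rewrite sumr_const -[leLHS]mulr_natl; apply/le_of_eq; congr (_%:R * _).
  by rewrite cardC1 card_ord.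
have q2 : q.-1%:R = q%:R - 1 :> R by rewrite -subn1 natrB //; lia.
have qq : q%:R * q%:R^-1 = 1 :> R by rewrite mulfV // gt_eqF.
have e' : 0 <= e / q%:R by rewrite divr_ge0 ?ltW.
move: B; rewrite q2.
have -> : (q%:R - 1) * (N%:R * (q%:R^-1 + e / q%:R)) =
  N%:R - N%:R * q%:R^-1 + N%:R * e - N%:R * (e / q%:R).
  by field; rewrite gt_eqF.
have Ne : 0 <= N%:R * (e / q%:R) by rewrite mulr_ge0.
lra.
Unshelve. all: by end_near.
Qed.
End Digits.

(** * Real numbers with prescribed bits *)

Lemma prefix_word_masked (m b : nat -> bool) l :
  masked m l (prefix_word b l) = prefix_word (fun i => m i && b i) l.
Proof.
elim: l => [|l IH]; first by rewrite /masked big_ord0.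
by rewrite /= masked_step IH mulnb.
Qed.

Lemma prefix_word_lt (b : nat -> bool) l : (prefix_word b l < 2 ^ l)%N.
Proof. by elim: l => //= l IH; rewrite expnS; case: (b l); lia. Qed.

Lemma prefix_word_cylinder (b : nat -> bool) l d :
  (prefix_word b l * 2 ^ d <= prefix_word b (l + d) < (prefix_word b l).+1 * 2 ^ d)%N.
Proof.
elim: d => [|d IH]; first by rewrite addn0 expn0 !muln1 leqnn ltnSn.
by rewrite addnS expnS /=; case: (b (l + d)%N); lia.
Qed.

Section Binary.
Variables (R : realType) (b : nat -> bool).

Lemma sum_bits n : \sum_(1 <= j < n.+1) (b j.-1 : nat)%:R / 2 ^+ j =
  (prefix_word b n)%:R / 2 ^+ n :> R.
Proof.
elim: n => [|n IH]; first by rewrite big_geq //= mul0r.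
rewrite big_nat_recr //= IH natrD natrM exprS; field.
by rewrite expf_neq0.
Qed.

(** A zero bit keeps [x] away from 1. *)
Lemma binary_real : (forall N, exists2 i, (N <= i)%N & ~~ b i) ->
  exists2 x : R, 0 <= x < 1 & forall l,
    (prefix_word b l)%:R / 2 ^+ l <= x <= (prefix_word b l)%:R / 2 ^+ l + 2 ^- l.
Proof.
move=> zeros; pose u l : R := (prefix_word b l)%:R / 2 ^+ l.
have L0 l : 0 < 2 ^+ l :> R by rewrite exprn_gt0.
have nest l l' : (l <= l')%N -> u l <= u l' <= u l + 2 ^- l.
  move=> /subnKC <-; set d := (l' - l)%N.
  have /andP[lo hi] := prefix_word_cylinder b l d.
  rewrite /u exprD -[X in _ <= _ + X]mul1r -mulrDl.
  have E : 2 ^+ d != 0 :> R by rewrite expf_neq0.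
  have -> : (prefix_word b l)%:R / 2 ^+ l =
     (prefix_word b l * 2 ^ d)%N%:R / (2 ^+ l * 2 ^+ d) :> R.
    by rewrite natrM natrX; field; rewrite E expf_neq0.
  rewrite ler_pM2r ?invr_gt0 ?mulr_gt0 // ler_nat lo /=.
  rewrite ler_pdivrMr ?mulr_gt0 // mulrA divfK ?gt_eqF // mulrDl mul1r -natrX.
  by rewrite -natrM -natrD ler_nat; lia.
have cu : u n @[n --> \oo] --> limn u.
  apply: nondecreasing_is_cvgn => [m n /nest/andP[]//|].
  by exists (u 0%N + 2 ^- 0) => _ [n _ <-]; have /andP[] := nest 0%N n (leq0n _).
have ux l : u l <= limn u <= u l + 2 ^- l.
  apply/andP; split.
    apply: limr_ge; first exact: cu.
    by near=> n; have /andP[] : u l <= u n <= u l + 2 ^- l by apply: nest; near: n; exact: nbhs_infty_ge.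
  apply: limr_le; first exact: cu.
  by near=> n; have /andP[] : u l <= u n <= u l + 2 ^- l by apply: nest; near: n; exact: nbhs_infty_ge.
exists (limn u) => //.
have [i _ bi] := zeros 0%N.
have /andP[_ hi] := ux i.+1; have /andP[lo _] := ux 0%N.
apply/andP; split; first by apply: le_trans lo; rewrite /u mul0r.
apply: le_lt_trans hi _; rewrite /u /= (negbTE bi) addn0.
rewrite -[X in _ + X]mul1r -mulrDl ltr_pdivrMr // mul1r natr1 -natrX ltr_nat.
by have := prefix_word_lt b i; rewrite expnS; lia.
Unshelve. all: by end_near.
Qed.
End Binary.

Lemma leq_scale i k : (0 < k)%N -> (i <= scale k)%N = (2 ^ i <= k)%N.
Proof.
move=> k0; apply/idP/idP => [ik|]; last exact: trunc_log_max.
have /andP[kg _] := @trunc_log_bounds 2 k isT k0.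
by apply: leq_trans kg; rewrite leq_exp2l.
Qed.

Lemma scaleS k : (0 < k)%N -> (scale k.+1 <= (scale k).+1)%N.
Proof.
move=> k0; rewrite /scale -trunc_logMp //; apply: leq_trunc_log.
by rewrite mul2n -addnn -addn1 leq_add2l.
Qed.

(** Take the largest [k] with [scale k * 2 ^ k <= N], and [c] next above [N / 2 ^ k]; rounding
    [N] up to [c * 2 ^ k] costs a relative error of at most [1 / scale k]. *)
Lemma block_exists K N : (0 < K)%N -> (1 < scale K)%N -> (scale K * 2 ^ K <= N)%N ->
  exists k c, [/\ (K <= k)%N, (c < 4 * scale k)%N, (N <= c * 2 ^ k)%N &
    (c * 2 ^ k * scale k <= N * (scale k).+1)%N].
Proof.
move=> K0 K1 KN; pose P k := (K <= k)%N && (scale k * 2 ^ k <= N)%N.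
have sK k : (K <= k)%N -> (1 < scale k)%N.
  by move=> Kk; apply: leq_trans K1 _; exact: leq_trunc_log.
have exP : exists k, P k by exists K; rewrite /P leqnn.
have ubP k : P k -> (k <= N)%N.
  case/andP=> Kk; apply: leq_trans; have := ltn_expl k (isT : (1 < 2)%N).
  have := sK k Kk; nia.
case: (ex_maxnP exP ubP) => k /andP[Kk kN] kmax.
have gk := sK k Kk; have k0 : (0 < k)%N by lia.
have x0 : (0 < 2 ^ k)%N by rewrite expn_gt0.
have Nlt : (N < scale k.+1 * 2 ^ k.+1)%N.
  by rewrite ltnNge; apply/negP => H; have := kmax k.+1; rewrite /P H (leqW Kk) => /(_ isT); lia.
have Sk := scaleS k0.
exists k, (N %/ 2 ^ k).+1; split=> //.
- have : (N %/ 2 ^ k < 2 * (scale k).+1)%N.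
    rewrite ltn_divLR //; apply: leq_trans Nlt _; rewrite expnS; nia.
  lia.
- by rewrite ltnW // ltn_ceil.
- have := leq_divM N (2 ^ k); nia.
Qed.

Lemma normal_of_good (R : realType) (m b : nat -> bool) (k0 q : nat) (x : R) :
  odd q -> (2 < q)%N -> 0 <= x < 1 ->
  (forall k, (k0 <= k)%N -> (1 < k)%N -> good m k (prefix_word b (len k))) ->
  (forall l, let A := prefix_word (fun i => m i && b i) l in
     A%:R / 2 ^+ l <= x <= A%:R / 2 ^+ l + 2 ^- l) ->
  simply_normal_in_base q x.
Proof.
move=> oq q2 x01 G Ax; have q1 : (1 < q)%N by lia.
apply: simply_normal_of_upper => // e e0.
have [K1 K1P] := len_large.
pose T := (Num.truncn (17 / e)).+1.
have [K2 K2P] := scale_unbounded (q + T + 2).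
pose K := (k0 + K1 + K2 + 2)%N.
exists (scale K * 2 ^ K)%N => N a KN aq.
have sK k : (K <= k)%N -> (q + T + 2 <= scale k)%N by move=> Kk; apply: K2P; lia.
have [||k [c [Kk c4 Nc cN]]] := block_exists _ _ KN.
- by rewrite /K; lia.
- by have := sK K (leqnn _); lia.
have gk := sK k Kk; set g := scale k in gk c4 cN *.
have sm : (q ^ (c * 2 ^ k) * (q * g ^ 4) <= 2 ^ len k)%N.
  by apply: K1P; [lia | lia | rewrite leq_mul2r ltnW ?orbT].
have H : (digit_count q x a N <= hits m q a (len k) (prefix_word b (len k)) (c * 2 ^ k))%N.
  apply: leq_trans (digit_count_homo _ _ _ Nc) _.
  apply: leq_sum => i _; case: eqP => //= <-.
  rewrite prefix_word_masked (hit_digit q1 x01 (Ax (len k))) //.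
  apply: leq_trans sm; apply: (@leq_trans (q ^ (c * 2 ^ k))%N).
    by rewrite leq_exp2l.
  by rewrite leq_pmulr // muln_gt0 expn_gt0; lia.
have := G k _ _; rewrite /good -/g.
have kk0 : (k0 <= k)%N by lia.
have k1 : (1 < k)%N by lia.
have qg : (q < g)%N by lia.
move=> /(_ kk0 k1) /forallP/(_ (Ordinal qg))/implyP; rewrite /= oq q2 => /(_ isT).
move=> /forallP/(_ (Ordinal aq))/forallP/(_ (Ordinal c4)) /= B.
have C : (digit_count q x a N * (q * g) * g <= N * g.+1 * (g + 8))%N.
  apply: (@leq_trans (c * 2 ^ k * (g + 8) * g)%N).
    by rewrite leq_mul2r; apply/orP; right; apply: leq_trans B; rewrite leq_mul2r H orbT.
  by rewrite mulnAC leq_mul2r cN orbT.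
have qR : 0 < q%:R :> R by rewrite ltr0n; lia.
have gR : 0 < g%:R :> R by rewrite ltr0n; lia.
have g1 : 1 <= g%:R :> R by rewrite ler1n; lia.
have ge : 17 <= g%:R * e.
  rewrite -ler_pdivrMr //; apply: (@le_trans _ _ T%:R); first by rewrite ltW // truncnS_gt.
  by rewrite ler_nat; lia.
move: C; rewrite -(ler_nat R) !natrM natrD -natr1.
move: (digit_count _ _ _ _)%:R (N%:R : R) (ler0n R N) => D n n0 C.
have E : (g%:R + 1) * (g%:R + 8) <= g%:R * (g%:R + 17) :> R by nra.
have F : D * (q%:R * g%:R) <= n * (g%:R + 17).
  rewrite -(ler_pM2r gR); apply: le_trans C _.
  by rewrite -!mulrA ler_wpM2l // [X in _ <= X]mulrC.
have -> : n * (q%:R^-1 + e) = n * (1 + q%:R * e) / q%:R by field; rewrite gt_eqF.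
rewrite ler_pdivlMr // -(ler_pM2r gR) -mulrA; apply: le_trans F _.
rewrite -mulrA ler_wpM2l //.
have q1R : 1 <= q%:R :> R by rewrite ler1n; lia.
nra.
Qed.

Lemma tcomp_good (m : nat -> bool) : tcomp 1 (fun s => m (nth 0%N s 0)) ->
  tcomp 2 (fun s => good m (nth 0%N s 0) (nth 0%N s 1)).
Proof.
move=> cm.
have cm' k F : tcomp k F -> tcomp k (fun s => m (F s)) by exact: (@tcomp_op1 (fun i => m i)).
have c_scale k F : tcomp k F -> tcomp k (fun s => scale (F s)).
  apply: (@tcomp_op1 scale).
  apply: (@tcomp_ext _ (fun s => \sum_(i < nth 0 s 0) (2 ^ i.+1 <= nth 0 s 0))%N).
    move=> s _; set k' := nth _ _ _; have [->|k0] := posnP k'.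
      by rewrite big_ord0.
    rewrite (eq_bigr (fun i : 'I_k' => nat_of_bool (i < scale k')%N)) => [|i _]; last first.
      by rewrite leq_scale.
    rewrite -big_mkcond /=.
    have sk : (scale k' <= k')%N.
      by case/andP: (@trunc_log_bounds 2 k' isT k0) => /(leq_trans (ltnW (ltn_expl _ (isT : 1 < 2)%N))).
    by rewrite -(big_ord_widen k' (fun=> 1%N) sk) sum1_card card_ord.
  apply: (@tcomp_sum _ _ (fun s => 2 ^ (nth 0 s 0).+1 <= nth 0 s 1)%N); computability.
have c_masked k F G : tcomp k F -> tcomp k G -> tcomp k (fun s => masked m (F s) (G s)).
  apply: (@tcomp_op2 (masked m)).
  apply: (@tcomp_sum _ _ (fun s => m (nth 0 s 0) *
    (nth 0 s 2 %/ 2 ^ (nth 0 s 1 - (nth 0 s 0).+1) %% 2) * 2 ^ (nth 0 s 1 - (nth 0 s 0).+1))%N).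
    by computability.
  by computability; apply: cm'; computability.
have c_hits : tcomp 5 (fun s => hits m (nth 0 s 2) (nth 0 s 1) (len (nth 0 s 3)) (nth 0 s 4)
    (nth 0 s 0 * 2 ^ nth 0 s 3))%N.
  apply: (@tcomp_sum _ _ (fun s => hit (nth 0 s 3) (nth 0 s 2) (len (nth 0 s 4))
     (masked m (len (nth 0 s 4)) (nth 0 s 5)) (nth 0 s 0).+1)%N).
    by computability.
  rewrite /hit /len; computability; apply: c_masked; computability.
apply: (@tcomp_all _ _ (fun s => (odd (nth 0 s 0) && (2 < nth 0 s 0)) ==>
  [forall a : 'I_(nth 0 s 0), [forall c : 'I_(4 * scale (nth 0 s 1)),
    hits m (nth 0 s 0) a (len (nth 0 s 1)) (nth 0 s 2) (c * 2 ^ nth 0 s 1) *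
     (nth 0 s 0 * scale (nth 0 s 1)) <=
      c * 2 ^ nth 0 s 1 * (scale (nth 0 s 1) + 8)]])%N).
  by apply: c_scale; computability.
computability.
apply: (@tcomp_all _ _ (fun s => [forall c : 'I_(4 * scale (nth 0 s 2)),
    hits m (nth 0 s 1) (nth 0 s 0) (len (nth 0 s 2)) (nth 0 s 3) (c * 2 ^ nth 0 s 2) *
     (nth 0 s 1 * scale (nth 0 s 2)) <=
      c * 2 ^ nth 0 s 2 * (scale (nth 0 s 2) + 8)])%N); first by computability.
apply: (@tcomp_all _ _ (fun s => hits m (nth 0 s 2) (nth 0 s 1) (len (nth 0 s 3)) (nth 0 s 4)
    (nth 0 s 0 * 2 ^ nth 0 s 3) * (nth 0 s 2 * scale (nth 0 s 3)) <=
      nth 0 s 0 * 2 ^ nth 0 s 3 * (scale (nth 0 s 3) + 8))%N).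
  by computability; apply: c_scale; computability.
by computability; apply: c_scale; computability.
Qed.

(** * Sparse Cantor sets contain computable normal numbers *)

(** The given program need not be correct at 0; only successors are tested. *)
Lemma tcomp_allowed (S : set nat) : computable_set S ->
  tcomp 1 (fun s => allowed S (nth 0%N s 0)).
Proof.
case=> p cp pS.
have cs : tcomp 1 (fun s => (nth 0%N s 0).+1) by computability.
apply: tcomp_graph (computable_comp cp (fun=> cs)) _ => v y.
have E (w : 1.-tuple nat) : (forall i : 'I_1, tnth w i = (nth 0%N v 0).+1) ->
    w = nat_code (nth 0%N v 0).+1.
  by move=> wv; apply: eq_from_tnth => i; rewrite wv (tnth_nth 0%N) ord1.
split=> [[w [wv pw]]|->].
  by move: pw; rewrite (E _ wv) => /(pS (nth 0%N v 0).+1 isT).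
exists (nat_code (nth 0%N v 0).+1); split=> [i|]; last exact: (pS (nth 0%N v 0).+1 isT _).2 erefl.
by rewrite (tnth_nth 0%N) ord1.
Qed.

(** A cofinite set has density 1. *)
Lemma allowed_has_zeros (R : realType) (S : set nat) : density_zero R S ->
  forall N, exists2 i, (N <= i)%N & ~~ allowed S i.
Proof.
move=> dz N; apply: contrapT => none.
have all1 i : (N <= i)%N -> i.+1 \in S.
  by move=> Ni; apply: contrapT => /negP h; apply: none; exists i.
have /cvgrPdist_lt/(_ (1 / 2)) := dz; case=> [|K _ KP]; first by lra.
pose n := (K + 2 * N + 1)%N.
have nK : (K <= n)%N by rewrite /n; lia.
have := KP n nK; rewrite /= sub0r normrN ger0_norm ?divr_ge0 //.
rewrite ltr_pdivrMr ?ltr0n; last by rewrite /n; lia.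
have : (n - N <= cardS S 1 n)%N.
  rewrite /cardS -sum1_count big_mkcond /= (big_cat_nat (n := N.+1)) //=; last by rewrite /n; lia.
  apply: leq_trans (leq_addl _ _).
  rewrite (eq_big_nat _ _ (F2 := fun=> 1%N)) => [|i /andP[Ni _]].
    by rewrite sum_nat_const_nat muln1 subSS.
  by case: i Ni => // i Ni; rewrite all1.
have : (n <= 2 * (n - N))%N by rewrite /n; lia.
rewrite -!(ler_nat R) natrM; lra.
Qed.

Theorem theorem3 (R : realType) (S : set nat) (rho : R)
  (S_pos : forall k : nat, S k -> (0 < k)%N)
  (S_sparse : sparse R S)
  (S_comp : computable_set S)
  (rho_exp : sparsity_exponent S rho)
  (rho_comp : computable_real rho) :
  exists b : rat -> nat -> nat,
    computable_on rat_nat_code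
      [set t : rat * nat | 0 < t.1 < 2 / 3 /\ (0 < t.2)%N]
      (fun t => b t.1 t.2) /\
    forall eps : rat, 0 < eps < 2 / 3 ->
      exists x : R,
        [/\ (\sum_(1 <= n < N.+1) (b eps n)%:R / 2 ^+ n) @[N --> \oo] --> x,
            is_expansion 2 x (b eps),
            sparse_cantor S x
          & forall q : nat, (1 < q)%N -> odd q -> normal_in_base q x].
Proof.
have cm := tcomp_allowed S_comp.
have zeros := allowed_has_zeros S_sparse.1.
have [k0 k0P] := good_almost_all R (sparse_dense rho_exp).
have c_len : tcomp 1 (fun s => len (nth 0%N s 0)) by rewrite /len; computability.
have len_homo : {homo len : i j / (i <= j)%N} by move=> i j ij; rewrite leq_exp2l.
have len_ge j : (j <= len j)%N by rewrite ltnW // ltn_expl.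
have [beta c_beta goodP] :=
  computable_derandomization (tcomp_good cm) c_len len_homo len_ge k0P.
pose bits i := allowed S i && beta i.
exists (fun _ n => nat_of_bool (bits n.-1)); split.
  have c2 : tcomp 2 (fun s => bits (nth 0%N s 1).-1).
    have cm' k F : tcomp k F -> tcomp k (fun s => allowed S (F s)).
      exact: (@tcomp_op1 (fun i => allowed S i)).
    have cb' k F : tcomp k F -> tcomp k (fun s => beta (F s)).
      exact: (@tcomp_op1 (fun i => beta i)).
    by rewrite /bits; computability; [apply: cm' | apply: cb']; computability.
  by eexists; first exact: c2.
move=> _ _.
have [|x x01 xP] := @binary_real R bits.
  by move=> N; have [i Ni im] := zeros N; exists i; rewrite // /bits (negbTE im).
have cvgx : (\sum_(1 <= n < N.+1) (bits n.-1 : nat)%:R / 2 ^+ n) @[N --> \oo] --> x.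
  by apply: (@cvg_within_pow _ 2) => // n; rewrite sum_bits; exact: xP.
exists x; split=> //.
- split=> [j _||[N H]].
  + by case: (bits _).
  + have -> : Num.floor x = 0 by apply/eqP; rewrite floor_eq /= mulr0z.
    by rewrite subr0.
  + have [i Ni im] := zeros N; have := H i.+1 (leqW Ni).
    by rewrite /bits /= (negbTE im).
- split=> //; exists (fun k => beta k.-1).
  rewrite -cvg_shiftS; apply: cvg_trans cvgx; apply: near_eq_cvg; apply: nearW => N /=.
  rewrite [RHS]big_mkcond [RHS]big_ltn //= ifF ?add0r; last first.
    by apply/negbTE/negP; rewrite inE => /S_pos.
  apply: eq_big_nat => i /andP[i0 _]; rewrite /bits /allowed prednK //.
  by case: (i \in S) => //=; rewrite mul0r.
- move=> q q1 oq j j0; have q2 : (2 < q)%N by case: q q1 oq => [|[|[|]]].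
  apply: (@normal_of_good R (allowed S) beta k0) => //.
  + by rewrite oddX oq orbT.
  + by apply: leq_trans q2 _; rewrite -{1}[q]expn1 leq_exp2l.
Qed.
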